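(* Let $\mathcal{G}(y)$, $y\in\mathcal{Y}$, be the parametrized family of $N$-player network aggregative games described in the context, with operator $F(x,y)=[\nabla_{x^i}J^i(x^i,z^i(x),y^i)^\top]_{i=1}^N$. Suppose that: (A1) (Constraints) for each $i$, $\mathcal{X}^i=\{x^i\in\mathbb{R}^n\mid B^ix^i\le b^i,\ H^ix^i=h^i\}$ for some $B^i\in\mathbb{R}^{m_i\times n}$, $b^i\in\mathbb{R}^{m_i}$, $H^i\in\mathbb{R}^{p_i\times n}$, $h^i\in\mathbb{R}^{p_i}$, and there exists $x^i\in\mathcal{X}^i$ such that $B^ix^i<b^i$; (A2) (Cost functions) for all $y^i\in\mathcal{Y}^i$, the function $x^i\mapsto J^i(x^i,z^i(x),y^i)$ is twice continuously differentiable and strongly convex in $x^i$ for all $i\in\{1,\dots,N\}$ and for all $x^{-i}\in\mathcal{X}^{-i}=\prod_{j\ne i}\mathcal{X}^j$; moreover $[x^i;z^i]\mapsto J^i(x^i,z^i,y^i)$ is twice continuously differentiable in $[x^i;z^i]$; (A3) (Strong monotonicity) the operator $[x,y]\mapsto F(x,y)$ is continuously differentiable in $[x,y]\in\mathcal{X}\times\mathcal{Y}$ and it is strongly monotone in $x\in\mathcal{X}$ for any fixed $y\in\mathcal{Y}$. Then for all $y\in\mathcal{Y}$ the game $\mathcal{G}(y)$ admits a unique Nash equilibrium $x^\star(y)$. If additionally the following holds for $\bar y\in\mathcal{Y}$: (A4) (Constraint qualification) let $B^0,b^0$ be obtained by deleting from $B,b$ all the rows corresponding to constraints that are not active at $x^\star(\bar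 y)$ (i.e. the rows $k\in\{1,\dots,m\}$ such that $B_{(k,:)}x^\star(\bar y)<b_k$), and let $A:=[B^0;H]$ ($B^0$ stacked on top of $H$). Then (1) $A$ has full row rank; and (2) the strict complementary slackness condition holds: $\lambda_k(\bar y)>0$ when $B_{(k,:)}x^\star(\bar y)=b_k$, where $\lambda(\bar y)$ is the (unique) multiplier of the inequality constraints in the KKT system at $x^\star(\bar y)$ given in the context; then $x^\star(y)$ is locally differentiable at $\bar y$ and $$\nabla_y x^\star(\bar y)=-M\,[\nabla_yF(x,y)]_{\{x=x^\star(\bar y),\,y=\bar y\}},$$ where $$M:=L-LA^\top[ALA^\top]^{-1}AL,\qquad L:=[\nabla_xF(x,y)]_{\{x=x^\star(\bar y),\,y=\bar y\}}^{-1}.$$ Moreover, $M\succeq0$.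
   Context: Setting. There are $N$ players interacting over a network with non-negative adjacency matrix $P\in\mathbb{R}^{N\times N}$, $P_{ii}=0$ for all $i$. Player $i$ selects a strategy $x^i$ in its feasible set $\mathcal{X}^i\subseteq\mathbb{R}^n$ to minimize the real-valued cost $J^i(x^i,z^i(x),y^i)$, where $z^i(x):=\sum_{j=1}^N P_{ij}x^j\in\mathbb{R}^n$ and $y^i\in\mathcal{Y}^i\subseteq\mathbb{R}^{d_i}$ is a parameter. Notation: $x:=[x^i]_{i=1}^N\in\mathbb{R}^{Nn}$ and $y:=[y^i]_{i=1}^N$ are stacked vectors, $\mathcal{X}:=\mathcal{X}^1\times\dots\times\mathcal{X}^N$, $\mathcal{Y}:=\mathcal{Y}^1\times\dots\times\mathcal{Y}^N$. For $y\in\mathcal{Y}$ the resulting game is denoted $\mathcal{G}(y)$ (the network aggregative game with parameter $y$). Nash equilibrium: $x^\star(y)=[x^{\star i}(y)]_{i=1}^N$ with $x^{\star i}(y)\in\mathcal{X}^i$ is a Nash equilibrium of $\mathcal{G}(y)$ if for all $i$ and all $x^i\in\mathcal{X}^i$, $J^i(x^{\star i}(y),\sum_jP_{ij}x^{\star j}(y),y^i)\le J^i(x^i,\sum_jP_{ij}x^{\star j}(y),y^i)$. Stacked constraints: $m=\sum_im_i$, $p=\sum_ip_i$, $B=\mathrm{blkdiag}(B^1,\dots,B^N)$, $b=[b^i]_{i=1}^N$, $H=\mathrm{blkdiag}(H^1,\dots,H^N)$, $h=[h^i]_{i=1}^N$, so $\mathcal{X}=\{x\in\mathbb{R}^{Nn}\mid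 Bx\le b,\ Hx=h\}$. $B_{(k,:)}$ is the $k$-th row of $B$. Operator: $F:\mathcal{X}\times\mathcal{Y}\to\mathbb{R}^{Nn}$, $F(x,y):=[\nabla_{x^i}J^i(x^i,z^i(x),y^i)^\top]_{i=1}^N$, the stacked gradients of each player's cost with respect to the player's own strategy. KKT system: the multipliers at $x^\star(y)$ are $\lambda(y)\in\mathbb{R}^m$, $\mu(y)\in\mathbb{R}^p$ satisfying $F(x^\star(y),y)+B^\top\lambda(y)+H^\top\mu(y)=0$, $Hx^\star(y)=h$, $\lambda(y)^\top(Bx^\star(y)-b)=0$, $Bx^\star(y)\le b$, $\lambda(y)\ge0$. Strong monotonicity (definition as given in the paper): an operator $f:\mathcal{X}\subseteq\mathbb{R}^n\to\mathbb{R}^n$ is strongly monotone in $\mathcal{X}$ if there exists $\alpha>0$ such that $(f(x_1)-f(x_2))^\top(x_1-x_2)\ge\alpha\|x_1-x_2\|^2$ for all $x_1,x_2\in\mathcal{X}$. Equivalently, for all $x\in\mathcal{X}$, $\frac{\nabla_xf(x)+\nabla_xf(x)^\top}{2}\succeq\alpha I_n$. Conventions: $\nabla$ denotes the Jacobian. For a square matrix $Q$, not necessarily symmetric, $Q\succ0$ (resp. $Q\succeq0$) means $x^\top Qx>0$ (resp. $\ge0$) for all $x\ne0$.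
   Formalization: Strong monotonicity is taken to require both displayed forms, the inequality and the Jacobian condition on X; with equality constraints they are not equivalent, and under the inequality alone the Jacobian of F in x can be singular, leaving L and M undefined. *)

(* Defs.v *)
From HB Require Import structures.
From mathcomp Require Export all_boot all_order all_algebra.
From mathcomp Require Export all_classical all_reals all_analysis.
Export Order.TTheory GRing.Theory Num.Theory.
Export numFieldNormedType.Exports.

Set Implicit Arguments.
Unset Strict Implicit.
Unset Printing Implicit Defensive.

Local Open Scope classical_set_scope.
Local Open Scope ring_scope.

Section LinearAlgebra.
Context {R : realType}.

(* The library norm on matrices is the sup norm; the Euclidean norm used here
   is [dotv u u] (squared). *)
Definition dotv (k : nat) (u v : 'cV[R]_k) : R := (u^T *m v) 0 0.

Definition vle (k : nat) (u v : 'cV[R]_k) : Prop := forall i, u i 0 <= v i 0.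
Definition vlt (k : nat) (u v : 'cV[R]_k) : Prop := forall i, u i 0 < v i 0.

(* [Q] is not assumed symmetric. *)
Definition psd (k : nat) (Q : 'M[R]_k) : Prop :=
  forall v : 'cV[R]_k, v != 0 -> 0 <= dotv v (Q *m v).

Definition polyhedron (n m p : nat) (B : 'M[R]_(m, n)) (b : 'cV[R]_m)
    (H : 'M[R]_(p, n)) (h : 'cV[R]_p) : set 'cV[R]_n :=
  [set x | vle (B *m x) b /\ H *m x = h].

(* All blocks have [n] columns, so that the result acts on stacked vectors of
   R^(Nn). *)
Definition blkdiag (N n : nat) (r : 'I_N -> nat) (B : forall i, 'M[R]_(r i, n)) :
    'M[R]_(\sum_(i < N) r i, \sum_(i < N) n) :=
  \mxblock_(i < N, j < N) (if i == j then B i else 0).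

(* Stacked vectors [x^i]_i are elements of 'cV_(\sum_i q i), built by [\mxcol_i]
   and read by [submxcol x i]. *)
Definition prodset (N : nat) (q : 'I_N -> nat) (S : forall i, set 'cV[R]_(q i)) :
    set 'cV[R]_(\sum_(i < N) q i) :=
  [set x | forall i, S i (submxcol x i)].

End LinearAlgebra.

Section Calculus.
Context {R : realType}.

(* Column vector of partial derivatives, i.e. the transposed Jacobian of a
   real-valued function. *)
Definition grad (n : nat) (f : 'cV[R]_n -> R) (a : 'cV[R]_n) : 'cV[R]_n :=
  \col_k 'D_(delta_mx k 0) f a.

(* Column-vector convention: [jac f a *m v] is the differential of [f] at [a]
   applied to [v], the transpose of the library's row-vector ['J f a]. *)
Definition jac (q r : nat) (f : 'cV[R]_q -> 'cV[R]_r) (a : 'cV[R]_q) : 'M[R]_(r, q) :=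
  \matrix_(i, j) ('D_(delta_mx j 0) f a) i 0.

(* Only used with [V] finite-dimensional, where continuity of [a |-> Df(a)v] for
   every [v] is continuity of [Df] in operator norm. *)
Fixpoint Ck (k : nat) (V W : normedModType R) (f : V -> W) (U : set V) : Prop :=
  if k is k'.+1 then
    (forall a, U a -> differentiable f a) /\ (forall v : V, Ck k' ('D_v f) U)
  else forall a, U a -> {for a, continuous f}.

(* [S] need not be open: being C^k on [S] means being C^k on an open set
   containing [S]. *)
Definition Ck_on (k : nat) (V W : normedModType R) (f : V -> W) (S : set V) : Prop :=
  exists U : set V, [/\ open U, S `<=` U & Ck k f U].

(* [f], as a function on [S], is differentiable around [a] with Jacobian [D] at
   [a]. As for [Ck_on], a function on a set that need not be open is
   differentiable around [a] when it coincides there with a function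
   differentiable on a neighbourhood of [a]; if [S] is itself a neighbourhood of
   [a], this says that [f] is differentiable near [a] and [jac f a = D]. *)
Definition loc_diff_jac (q r : nat) (S : set 'cV[R]_q) (f : 'cV[R]_q -> 'cV[R]_r)
    (a : 'cV[R]_q) (D : 'M[R]_(r, q)) : Prop :=
  exists g : 'cV[R]_q -> 'cV[R]_r,
    [/\ \forall y \near a, differentiable g y,
        \forall y \near a, S y -> g y = f y
      & jac g a = D].

Definition strongly_convex (n : nat) (S : set 'cV[R]_n) (f : 'cV[R]_n -> R) : Prop :=
  exists2 alpha : R, 0 < alpha &
    forall x1 x2 : 'cV[R]_n, S x1 -> S x2 -> forall t : R, 0 <= t <= 1 ->
      f (t *: x1 + (1 - t) *: x2) <=
        t * f x1 + (1 - t) * f x2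
        - alpha / 2 * t * (1 - t) * dotv (x1 - x2) (x1 - x2).

(* The second conjunct is the Jacobian form of strong monotonicity, with
   positive semidefiniteness tested on all directions of the ambient space. The
   two conjuncts are equivalent for [f] C^1 and [S] convex with nonempty
   interior; if [S] lies in a proper affine subspace, the second one implies the
   first but not conversely, and only the second one makes the Jacobian of [f]
   invertible on [S]. *)
Definition strongly_monotone (k : nat) (S : set 'cV[R]_k)
    (f : 'cV[R]_k -> 'cV[R]_k) : Prop :=
  exists2 alpha : R, 0 < alpha &
    (forall x1 x2, S x1 -> S x2 ->
       alpha * dotv (x1 - x2) (x1 - x2) <= dotv (f x1 - f x2) (x1 - x2)) /\
    (forall x, S x -> psd (2^-1 *: (jac f x + (jac f x)^T) - alpha%:M)).

End Calculus.

Section Game.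
Context {R : realType}.
Variables (N n : nat) (d : 'I_N -> nat).
Variable P : 'M[R]_N.
Variable J : forall i : 'I_N, 'cV[R]_n -> 'cV[R]_n -> 'cV[R]_(d i) -> R.

Definition aggregate (x : 'cV[R]_(\sum_(i < N) n)) (i : 'I_N) : 'cV[R]_n :=
  \sum_(j < N) P i j *: submxcol x j.

Definition is_nash (X : 'I_N -> set 'cV[R]_n) (y : 'cV[R]_(\sum_(i < N) d i))
    (x : 'cV[R]_(\sum_(i < N) n)) : Prop :=
  prodset X x /\
  forall i (xi : 'cV[R]_n), X i xi ->
    J (submxcol x i) (aggregate x i) (submxcol y i) <=
    J xi (aggregate x i) (submxcol y i).

(* The gradient acts on the first argument of [J i] only; since P i i = 0 the
   aggregate does not depend on the i-th strategy anyway. *)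
Definition game_op (x : 'cV[R]_(\sum_(i < N) n)) (y : 'cV[R]_(\sum_(i < N) d i)) :
    'cV[R]_(\sum_(i < N) n) :=
  \mxcol_(i < N) grad (fun xi => J xi (aggregate x i) (submxcol y i)) (submxcol x i).

End Game.

Section KKT.
Context {R : realType}.
Variables (k m p : nat).
Variables (B : 'M[R]_(m, k)) (b : 'cV[R]_m) (H : 'M[R]_(p, k)) (h : 'cV[R]_p).

(* [Fx] is the value of the operator at [x]. *)
Definition is_KKT (Fx x : 'cV[R]_k) (lam : 'cV[R]_m) (mu : 'cV[R]_p) : Prop :=
  [/\ Fx + B^T *m lam + H^T *m mu = 0,
      H *m x = h,
      lam^T *m (B *m x - b) = 0,
      vle (B *m x) b
    & vle 0 lam].

Definition active (x : 'cV[R]_k) : {set 'I_m} := [set l | (B *m x) l 0 == b l 0].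

(* [B] with the rows of the inactive constraints deleted. *)
Definition active_rows (x : 'cV[R]_k) : 'M[R]_(#|active x|, k) :=
  rowsub (fun l : 'I_#|active x| => enum_val l) B.

Definition active_mx (x : 'cV[R]_k) : 'M[R]_(#|active x| + p, k) :=
  col_mx (active_rows x) H.

End KKT.

(* Main.v *)
Require Import Defs.
From mathcomp Require Import all_boot all_order all_algebra.
From mathcomp Require Import all_classical all_reals all_analysis.
From mathcomp Require Import ring lra.
Import Order.TTheory GRing.Theory Num.Theory numFieldNormedType.Exports.

(* The equilibria are the solutions of the variational inequality (VI) of F over
   the polyhedron X. A solution exists without any fixed point theorem: by
   monotonicity the closed sets {x | <F u, u - x> >= 0} have the finite
   intersection property on a compact convex set, a common point solves the VI by
   Minty's argument, and strong monotonicity keeps the solution away from the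
   boundary of a large ball.

   For the sensitivity part, near ybar the game is replaced by the VI on the
   affine space where the constraints active at xbar are equalities. Near xbar
   the operator F(., y) is still strongly monotone, also for y outside Y, so the
   same existence result provides a solution g(y) on a whole neighbourhood of
   ybar, and strong monotonicity makes g Lipschitz. Linearizing
   F(g(y), y) \in range A^T, A g(y) = A xbar, gives the derivative of g. The
   multipliers -A'^T F(g(y), y), with A' a right inverse of A, are continuous in
   y, so by strict complementarity they remain positive and g(y) is the
   equilibrium for y in Y close to ybar. *)

Set Implicit Arguments.
Unset Strict Implicit.
Unset Printing Implicit Defensive.

Local Open Scope classical_set_scope.
Local Open Scope ring_scope.

(** * Euclidean inner product on column vectors *)

Section Dot.
Context {R : realType} {k : nat}.
Implicit Types (u v w : 'cV[R]_k).

Lemma dotvE u v : dotv u v = \sum_i u i 0 * v i 0.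
Proof. by rewrite /dotv mxE; apply: eq_bigr => i _; rewrite mxE. Qed.

Lemma dotvC u v : dotv u v = dotv v u.
Proof. by rewrite !dotvE; apply: eq_bigr => i _; rewrite mulrC. Qed.

Lemma dotvDl u v w : dotv (u + v) w = dotv u w + dotv v w.
Proof. by rewrite /dotv linearD /= mulmxDl mxE. Qed.

Lemma dotvZl a u v : dotv (a *: u) v = a * dotv u v.
Proof. by rewrite /dotv linearZ /= -scalemxAl mxE. Qed.

Lemma dotvNl u v : dotv (- u) v = - dotv u v.
Proof. by rewrite -scaleN1r dotvZl mulN1r. Qed.

Lemma dotvBl u v w : dotv (u - v) w = dotv u w - dotv v w.
Proof. by rewrite dotvDl dotvNl. Qed.

Lemma dotvDr u v w : dotv w (u + v) = dotv w u + dotv w v.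
Proof. by rewrite !(dotvC w) dotvDl. Qed.

Lemma dotvZr a u v : dotv u (a *: v) = a * dotv u v.
Proof. by rewrite !(dotvC u) dotvZl. Qed.

Lemma dotvNr u v : dotv u (- v) = - dotv u v.
Proof. by rewrite !(dotvC u) dotvNl. Qed.

Lemma dotvBr u v w : dotv w (u - v) = dotv w u - dotv w v.
Proof. by rewrite dotvDr dotvNr. Qed.

Lemma dotv0l v : dotv 0 v = 0.
Proof. by rewrite -(scale0r v) dotvZl mul0r. Qed.

Lemma dotv_ge0 v : 0 <= dotv v v.
Proof. by rewrite dotvE sumr_ge0 // => i _; rewrite -expr2 sqr_ge0. Qed.

Lemma dotv_eq0 v : dotv v v = 0 -> v = 0.
Proof.
rewrite dotvE => /psumr_eq0P v0; apply/colP => i; rewrite mxE.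
have /eqP := v0 (fun i _ => sqr_ge0 (v i 0)) i isT.
by rewrite mulf_eq0 orbb => /eqP.
Qed.

Lemma dotv_gt0 v : v != 0 -> 0 < dotv v v.
Proof.
move=> v0; rewrite lt_def dotv_ge0 andbT.
by apply: contra v0 => /eqP/dotv_eq0 ->.
Qed.

(** Expands [0 <= dotv (u - a *: v) (u - a *: v)]. It stands in for Cauchy-Schwarz without square
    roots: a bound [a |d|^2 <= <w, d>] with [0 <= a] yields [a^2 |d|^2 <= |w|^2]. *)
Lemma dotv_young (a : R) u v : 2 * a * dotv u v <= dotv u u + a ^+ 2 * dotv v v.
Proof.
have := dotv_ge0 (u - a *: v).
by rewrite dotvBl !dotvBr !dotvZl !dotvZr (dotvC v u); lra.
Qed.

(** With [dotv_le_normr_sqr], lets monotonicity estimates be made in the Euclidean norm and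
    differentials be handled in the sup norm. *)
Lemma normr_sqr_le_dotv v : `|v| ^+ 2 <= dotv v v.
Proof.
have h i : `|v i 0| ^+ 2 <= dotv v v.
  rewrite real_normK ?num_real// dotvE (bigD1 i) //= -expr2 lerDl.
  by rewrite sumr_ge0 // => j _; rewrite -expr2 sqr_ge0.
have -> : `|v| = mx_norm v by [].
have [|x0] := eqVneq (mx_norm v) 0.
  by move=> ->; rewrite expr0n /= dotv_ge0.
by have [[i j] ->] := mx_norm_neq0 x0; rewrite ord1.
Qed.

Lemma coord_le_normr v i : `|v i 0| <= `|v|.
Proof.
rewrite [leRHS]/Num.norm /= mx_normrE.
by apply/bigmax_geP; right => /=; exists (i, 0).
Qed.

Lemma dotv_le_normr_sqr v : dotv v v <= k%:R * `|v| ^+ 2.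
Proof.
rewrite dotvE mulr_natl -[X in _ *+ X]card_ord -sumr_const ler_sum // => i _.
rewrite -expr2 -(real_normK (num_real _)) lerXn2r ?nnegrE //.
exact: coord_le_normr.
Qed.

End Dot.

Lemma dotv_mulmx {R : realType} {k l : nat} (A : 'M[R]_(k, l)) u v :
  dotv u (A *m v) = dotv (A^T *m u) v.
Proof. by rewrite /dotv trmx_mul trmxK mulmxA. Qed.

(** * Limits of vector-valued maps and compactness in R^k *)

Section Cvg.
Context {R : realType} {T : Type} {F : set_system T} {FF : Filter F}.

Lemma cvg_sumr {I : Type} (r : seq I) (P : pred I) (f : I -> T -> R) (a : I -> R) :
  (forall i, P i -> f i x @[x --> F] --> a i) ->
  \sum_(i <- r | P i) f i x @[x --> F] --> \sum_(i <- r | P i) a i.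
Proof. by apply: cvg_big; exact: add_continuous. Qed.

Lemma cvg_maxr (f g : T -> R) (a b : R) : f @ F --> a -> g @ F --> b ->
  Num.max (f x) (g x) @[x --> F] --> Num.max a b.
Proof.
move=> fa gb; under eq_fun do rewrite maxr_absE.
rewrite maxr_absE; apply: cvgM; last exact: cvg_cst.
by apply: cvgD; [exact: cvgD|apply: cvg_norm; exact: cvgB].
Qed.

Lemma mx_cvgP {m n} (f : T -> 'M[R]_(m, n)) (a : 'M[R]_(m, n)) :
  f @ F --> a <-> forall i j, f x i j @[x --> F] --> a i j.
Proof.
split=> [fa i j|fa A [P aP PA]].
  exact: (@cvg_comp _ _ _ f (fun M : 'M[R]_(m, n) => M i j) _ _ _ fa
    (@coord_continuous _ _ _ i j a)).
apply: filterS (PA) _.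
by apply: filter_forall => i; apply: filter_forall => j; exact: fa (aP i j).
Qed.

Lemma cvg_dotv {k} (f g : T -> 'cV[R]_k) (a b : 'cV[R]_k) :
  f @ F --> a -> g @ F --> b -> dotv (f x) (g x) @[x --> F] --> dotv a b.
Proof.
move=> /mx_cvgP fa /mx_cvgP gb; under eq_fun do rewrite dotvE.
rewrite dotvE; apply: cvg_sumr => i _.
exact: cvgM.
Qed.

Lemma cvg_mulmx {m n p} (A : 'M[R]_(m, n)) (f : T -> 'M[R]_(n, p)) (a : 'M[R]_(n, p)) :
  f @ F --> a -> A *m f x @[x --> F] --> A *m a.
Proof.
move=> /mx_cvgP fa; apply/mx_cvgP => i j; under eq_fun do rewrite mxE.
rewrite mxE; apply: cvg_sumr => l _.
by apply: cvgM => //; exact: cvg_cst.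
Qed.

End Cvg.

Lemma closed_ge_fun {R : realType} {T : topologicalType} (f : T -> R) a :
  continuous f -> closed [set x | a <= f x].
Proof.
move=> cf; apply: (@preimage_closed T R f [set t | a <= t]).
  by move=> x _; exact: cf.
exact: closed_ge.
Qed.

(** Heine-Borel for row vectors is transported by transposition, which is continuous and preserves
    the sup norm. *)
Lemma bounded_closed_compact_cV {R : realType} {k} (A : set 'cV[R]_k) :
  bounded_set A -> closed A -> compact A.
Proof.
move=> bA cA.
have trc p q : continuous (@trmx R p q).
  move=> M; apply: (@mx_cvgP R _ (nbhs M) _ _ _ _ _).2 => i j; under eq_fun do rewrite mxE.
  by rewrite mxE; exact: coord_continuous.
have -> : A = trmx @` (trmx @^-1` A).
  apply/seteqP; split=> [x Ax|_ [x Ax <-]//].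
  by exists x^T; rewrite /= trmxK.
apply: continuous_compact; first by apply: continuous_subspaceT => x; exact: trc.
apply: bounded_closed_compact; last by apply: preimage_closed => // x _; exact: trc.
case: bA => M [Mr bA]; exists M; split=> // x /bA {}bA v /bA.
apply: le_trans; rewrite le_eqVlt; apply/orP; left; apply/eqP.
rewrite /Num.norm /= !mx_normrE.
rewrite (reindex (fun ij : 'I_k * 'I_1 => (ij.2, ij.1))) /=; last first.
  by exists (fun ij => (ij.2, ij.1)) => -[].
by apply: eq_bigr => ij _; rewrite mxE.
Qed.

(** * Monotone variational inequalities *)

(** The quadratic term is negligible for small [t]. This extracts a first order condition without
    taking a limit. *)
Lemma ge0_of_quadratic {R : realFieldType} (a b : R) :
  (forall t, 0 < t <= 1 -> 0 <= a * t + b * t ^+ 2) -> 0 <= a.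
Proof.
move=> h; rewrite leNgt; apply/negP => a0.
pose c : R := `|b| + 1.
have c0 : 0 < c by rewrite ltr_wpDl.
have bc : b < c by rewrite (le_lt_trans (ler_norm b)) // ltrDl.
(* This [t] satisfies [a + c * t = a * t], so [b < c] gives [a + b * t < a * t < 0]. *)
pose t := - a / (c - a).
have d0 : 0 < c - a by lra.
have t0 : 0 < t by rewrite divr_gt0 //; lra.
have t1 : t <= 1 by rewrite ler_pdivrMr //; lra.
have := h t; rewrite t0 t1 => /(_ isT).
have -> : a * t + b * t ^+ 2 = t * (a + b * t) by ring.
rewrite pmulr_rge0 //; apply/negP; rewrite -ltNge.
have : (c - a) * (a + b * t) < 0.
  have -> : (c - a) * (a + b * t) = - a * (b - c) - a ^+ 2.
    by rewrite /t; field; rewrite gt_eqF.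
  have : 0 < a ^+ 2 by rewrite exprn_even_gt0 //= lt_eqF.
  have : 0 < - a * (c - b) by rewrite mulr_gt0; lra.
  by lra.
by rewrite pmulr_rlt0.
Qed.

Section VariationalInequality.
Context {R : realType} {k : nat}.
Implicit Types (C : set 'cV[R]_k) (f : 'cV[R]_k -> 'cV[R]_k).

Definition solves_VI C f (x : 'cV[R]_k) :=
  C x /\ forall u, C u -> 0 <= dotv (f x) (u - x).

Definition segment_closed C := forall x y t,
  C x -> C y -> 0 <= t <= 1 -> C (x + t *: (y - x)).

(** For [alpha = 0] this is plain monotonicity. *)
Definition smono (alpha : R) C f := forall x1 x2, C x1 -> C x2 ->
  alpha * dotv (x1 - x2) (x1 - x2) <= dotv (f x1 - f x2) (x1 - x2).

Lemma cvg_dotv_sub (w u : 'cV[R]_k) (x : 'cV[R]_k) :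
  dotv w (u - z) @[z --> x] --> dotv w (u - x).
Proof.
apply: (@cvg_dotv _ _ (nbhs x) _ _ (fun=> w) (fun z => u - z)); first exact: cvg_cst.
apply: (@cvgB _ _ _ (nbhs x) _ (fun=> u) id); [exact: cvg_cst|exact: cvg_id].
Qed.

(* The minimizer over [C] of the total squared violation of the finitely many
   inequalities violates none of them: testing its first order condition at the
   points of [s], weighted by the violations, contradicts monotonicity. *)
Lemma minty_finite C f (s : seq 'cV[R]_k) : compact C -> C !=set0 ->
  segment_closed C -> smono 0 C f -> (forall u, u \in s -> C u) ->
  exists2 c, C c & forall u, u \in s -> 0 <= dotv (f u) (u - c).
Proof.
move=> cC C0 segC fmono sC.
pose viol (u z : 'cV[R]_k) : R := Num.max 0 (- dotv (f u) (u - z)).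
pose phi (z : 'cV[R]_k) : R := \sum_(u <- s) viol u z ^+ 2.
have [|c /set_mem Cc cmin] := @compact_EVT_min _ _ phi C C0 cC.
  apply: continuous_subspaceT => z.
  apply: (cvg_sumr (F := nbhs z)) => u _.
  have viol_cvg : viol u z' @[z' --> z] --> viol u z.
    apply: (cvg_maxr (F := nbhs z)); first exact: cvg_cst.
    by apply: (cvgN (F := nbhs z)); exact: cvg_dotv_sub.
  exact: (cvgM (F := nbhs z)).
exists c => //.
pose r u := viol u c.
have r0 u : 0 <= r u by rewrite le_max lexx.
(* The maximum in [viol] need not be differentiated: moving from [c] by [t *: (v - c)] changes each
   squared violation to at most [(r u + t * d) ^+ 2], whose linear coefficient in [t] is
   [2 * r u * d]. *)
have foc v : C v -> 0 <= \sum_(u <- s) r u * dotv (f u) (v - c).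
  move=> Cv; pose b := \sum_(u <- s) dotv (f u) (v - c) ^+ 2.
  suff : 0 <= 2 * \sum_(u <- s) r u * dotv (f u) (v - c).
    by rewrite pmulr_rge0.
  apply: (@ge0_of_quadratic _ _ b) => t /andP[t0 t1].
  have /cmin : c + t *: (v - c) \in C.
    by apply/mem_set/segC => //; rewrite ltW.
  rewrite -subr_ge0 => /le_trans; apply.
  rewrite mulr_sumr !mulr_suml -big_split /= /phi -sumrB ler_sum // => u _.
  rewrite -/(r u); set d := dotv (f u) (v - c).
  have e : - dotv (f u) (u - c) <= r u by rewrite le_max lexx orbT.
  suff : viol u (c + t *: (v - c)) ^+ 2 <= (r u + t * d) ^+ 2 by lra.
  rewrite /viol opprD addrA dotvBr dotvZr -/d.
  have [h|h] := leP 0 (- (dotv (f u) (u - c) - t * d)); last by rewrite expr0n sqr_ge0.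
  by rewrite lerXn2r ?nnegrE //; lra.
have rdot u : r u * dotv (f u) (u - c) = - r u ^+ 2.
  by rewrite /r /viol; have [h|h] := leP 0 (- dotv (f u) (u - c)); ring.
have tot : 0 <= \sum_(w <- s) r w * \sum_(u <- s) r u * dotv (f u) (w - c).
  rewrite big_seq sumr_ge0 // => w ws.
  by apply: mulr_ge0 => //; apply/foc/sC.
(* Adding the sum with [u] and [w] exchanged pairs the terms into
   [- r w * r u * dotv (f w - f u) (w - u)]. *)
have sym : \sum_(w <- s) \sum_(u <- s) r w * r u * dotv (f u) (w - u) <= 0.
  set S := (X in X <= 0).
  suff : S + S <= 0 by lra.
  rewrite {2}/S exchange_big /= /S -big_split /= big_seq sumr_le0 // => w ws.
  rewrite -big_split /= big_seq sumr_le0 // => u us.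
  have := fmono _ _ (sC _ ws) (sC _ us); rewrite mul0r => h.
  have : 0 <= r w * r u * dotv (f w - f u) (w - u) by rewrite !mulr_ge0.
  rewrite -(opprB w u) dotvNr dotvBl; lra.
(* Split [w - c] as [(w - u) + (u - c)]; the second part is evaluated by [rdot]. *)
have {}tot : (\sum_(w <- s) r w) * (\sum_(u <- s) r u ^+ 2) <= 0.
  move: tot; have -> : \sum_(w <- s) r w * \sum_(u <- s) r u * dotv (f u) (w - c)
    = \sum_(w <- s) \sum_(u <- s) r w * r u * dotv (f u) (w - u)
      - (\sum_(w <- s) r w) * (\sum_(u <- s) r u ^+ 2).
    rewrite mulr_suml -sumrB; apply: eq_bigr => w _.
    rewrite !mulr_sumr -sumrB; apply: eq_bigr => u _.
    have := rdot u; rewrite !dotvBr => e.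
    have {}e : r u * dotv (f u) c = r u * dotv (f u) u + r u ^+ 2 by lra.
    by rewrite mulrBr e; ring.
  by move=> h; lra.
move=> u us; suff : r u = 0.
  by rewrite /r /viol; have [h|h] := leP 0 (- dotv (f u) (u - c)); lra.
have le1 : r u <= \sum_(w <- s) r w.
  by rewrite (big_rem u us) /= lerDl sumr_ge0.
have le2 : r u ^+ 2 <= \sum_(w <- s) r w ^+ 2.
  by rewrite (big_rem u us) /= lerDl sumr_ge0 // => i _; rewrite sqr_ge0.
(* The cube of [r u] is bounded by the product of the two sums in [tot]. *)
apply/eqP; rewrite -[_ == _](@expf_eq0 _ _ 3) eq_le exprn_ge0 // andbT.
by rewrite exprS; apply: le_trans tot; rewrite ler_pM // sqr_ge0.
Qed.

Lemma VI_compact C f : compact C -> C !=set0 -> segment_closed C ->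
  smono 0 C f -> (forall x, C x -> {for x, continuous f}) ->
  exists x, solves_VI C f x.
Proof.
move=> cC C0 segC fmono fcont.
have [x Hx] : \bigcap_(u in C) (C `&` [set x | 0 <= dotv (f u) (u - x)]) !=set0.
  have := cC; rewrite compact_In0; apply.
    exists (fun u => [set x | 0 <= dotv (f u) (u - x)]) => // u _.
    by apply: closed_ge_fun => z; exact: cvg_dotv_sub.
  move=> D' D'C.
  have [|c Cc Hc] := @minty_finite C f (finmap.enum_fset D') cC C0 segC fmono.
    by move=> u /D'C /set_mem.
  by exists c => u uD'; split=> //; exact: Hc.
case: C0 => u0 Cu0; have [Cx _] := Hx _ Cu0.
exists x; split=> // u Cu.
(* Minty's argument: the inequality known at the test point [x + t *: (u - x)], divided by [t], says
   [0 <= g t]; as [t] tends to 0 from the right, [f] ends up evaluated at [x]. *)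
pose g (t : R) := dotv (f (x + t *: (u - x))) (u - x).
have gcvg : g t @[t --> 0^'+] --> dotv (f x) (u - x).
  apply: (@cvg_dotv _ _ (0^'+) _ _ (fun t => f (x + t *: (u - x))) (fun=> u - x));
    last exact: cvg_cst.
  have e : x + t *: (u - x) @[t --> 0^'+] --> x.
    rewrite -[X in _ --> X]addr0; apply: cvgD; first exact: cvg_cst.
    rewrite -[X in _ --> X](scale0r (u - x)); apply: cvgZ; last exact: cvg_cst.
    exact: cvg_within.
  exact: cvg_comp e (fcont x Cx).
apply: (cvgr_to_ge gcvg).
near=> t.
have t0 : 0 < t by near: t; exact: nbhs_right_gt.
have t1 : t <= 1 by near: t; exact: nbhs_right_le.
have Cz : C (x + t *: (u - x)) by apply: segC => //; rewrite ltW.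
have [_ /=] := Hx _ Cz.
by rewrite addrAC subrr add0r dotvZr pmulr_rge0.
Unshelve. all: by end_near. Qed.

End VariationalInequality.

Section VIball.
Context {R : realType} {k : nat}.
Implicit Types (C : set 'cV[R]_k) (f : 'cV[R]_k -> 'cV[R]_k).

Lemma VI_unique alpha C f x1 x2 : 0 < alpha -> smono alpha C f ->
  solves_VI C f x1 -> solves_VI C f x2 -> x1 = x2.
Proof.
move=> a0 fm [C1 h1] [C2 h2]; apply/eqP; rewrite -subr_eq0.
apply/negPn/negP => /dotv_gt0 d0.
have := fm _ _ C1 C2; have := h1 _ C2; have := h2 _ C1.
have : 0 < alpha * dotv (x1 - x2) (x1 - x2) by rewrite mulr_gt0.
by rewrite -(opprB x1 x2) dotvNr (dotvBl (f x1)); lra.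
Qed.

(** Closed Euclidean ball, parametrized by the square of its radius to avoid square roots. *)
Definition eball (x0 : 'cV[R]_k) (r2 : R) := [set x | dotv (x - x0) (x - x0) <= r2].

Lemma eball_segment_closed x0 r2 : segment_closed (eball x0 r2).
Proof.
rewrite /eball => x y t /= Hx Hy /andP[t0 t1].
have -> : x + t *: (y - x) - x0 = (x - x0) + t *: ((y - x0) - (x - x0)).
  by rewrite addrAC opprB subrKA.
move: (x - x0) (y - x0) Hx Hy => a b Hx Hy.
have -> : dotv (a + t *: (b - a)) (a + t *: (b - a)) =
    (1 - t) * dotv a a + t * dotv b b - t * (1 - t) * dotv (b - a) (b - a).
  rewrite !(dotvDl, dotvDr, dotvZl, dotvZr, dotvNl, dotvNr) (dotvC b a); ring.
have h1 : 0 <= t * (1 - t) * dotv (b - a) (b - a).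
  by rewrite !mulr_ge0 ?dotv_ge0 ?subr_ge0.
have h2 : (1 - t) * dotv a a <= (1 - t) * r2 by rewrite ler_wpM2l ?subr_ge0.
have h3 : t * dotv b b <= t * r2 by rewrite ler_wpM2l.
by lra.
Qed.

Lemma cvg_dotv_sq (x0 x : 'cV[R]_k) :
  dotv (z - x0) (z - x0) @[z --> x] --> dotv (x - x0) (x - x0).
Proof.
have h : z - x0 @[z --> x] --> x - x0.
  by apply: (cvgB (F := nbhs x)); [exact: cvg_id|exact: cvg_cst].
exact: (cvg_dotv (F := nbhs x)).
Qed.

Lemma eball_closed x0 r2 : closed (eball x0 r2).
Proof.
have -> : eball x0 r2 = [set x | 0 <= r2 - dotv (x - x0) (x - x0)].
  by apply/seteqP; split=> x /=; rewrite subr_ge0.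
apply: closed_ge_fun => x; apply: (cvgB (F := nbhs x)); first exact: cvg_cst.
exact: cvg_dotv_sq.
Qed.

Lemma eball_compact x0 r2 : compact (eball x0 r2).
Proof.
apply: bounded_closed_compact_cV; last exact: eball_closed.
(* A square at most [r2] forces its root below [1 + r2], since [2 s <= 1 + s^2]. *)
exists (`|x0| + 1 + r2); split; first exact: num_real.
move=> M hM x /= Hx; apply: le_trans (ltW hM).
have h := le_trans (normr_sqr_le_dotv _) Hx.
have : `|x - x0| <= 1 + r2.
  have := sqr_ge0 (`|x - x0| - 1); have := sqr_ge0 (`|x - x0|); nra.
have := ler_normD (x - x0) x0; rewrite subrK; lra.
Qed.

(** Solve the VI on [C] cut by the ball, then show that the ball does not bind. Only the action of
    [f x0] on the directions [x - x0] matters, so [w] may be much smaller than [f x0]; this is what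
    keeps solutions close to [x0] in the local analysis. *)
Lemma VI_ball C f x0 w alpha r2 : closed C -> segment_closed C -> C x0 ->
  0 < alpha -> smono alpha (C `&` eball x0 r2) f ->
  (forall x, C x -> eball x0 r2 x -> {for x, continuous f}) ->
  (forall x, C x -> dotv (f x0) (x - x0) = dotv w (x - x0)) ->
  dotv w w < alpha ^+ 2 * r2 ->
  exists2 x, solves_VI C f x & alpha ^+ 2 * dotv (x - x0) (x - x0) <= dotv w w.
Proof.
move=> clC segC C0 a0 fm fc fw wr.
have a20 : 0 < alpha ^+ 2 by rewrite exprn_gt0.
have r20 : 0 < r2.
  by have := le_lt_trans (dotv_ge0 w) wr; rewrite pmulr_rgt0.
have B0 : eball x0 r2 x0 by rewrite /eball /= subrr dotv0l ltW.
have [||x y t [Cx Bx] [Cy By] t01||x [Cx Bx]|x [[Cx Bx] VIx]] :=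
  @VI_compact R k (C `&` eball x0 r2) f.
- rewrite setIC; apply: compact_closedI; [exact: eball_compact|exact: clC].
- by exists x0.
- by split; [exact: segC|exact: eball_segment_closed].
- move=> x1 x2 h1 h2; rewrite mul0r; apply: le_trans (fm _ _ h1 h2).
  by rewrite mulr_ge0 ?dotv_ge0 ?ltW.
- exact: fc.
(* Test the VI at [x0] and combine with strong monotonicity. By the assumption on [r2], [x] is then
   interior to the ball. *)
have est : alpha ^+ 2 * dotv (x - x0) (x - x0) <= dotv w w.
  have := fm _ _ (conj Cx Bx) (conj C0 B0).
  have := VIx _ (conj C0 B0); rewrite -(opprB x x0) dotvNr (dotvBl (f x)) fw // => h1 h2.
  have h3 : alpha * dotv (x - x0) (x - x0) <= dotv (- w) (x - x0).
    by rewrite dotvNl; lra.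
  have := dotv_young alpha (- w) (x - x0).
  rewrite (dotvNl w (- w)) dotvNr opprK.
  have : alpha * (alpha * dotv (x - x0) (x - x0)) <= alpha * dotv (- w) (x - x0).
    by rewrite ler_wpM2l // ltW.
  by lra.
exists x => //; split=> // u Cu.
have lt_r2 : dotv (x - x0) (x - x0) < r2.
  by rewrite -(ltr_pM2l a20); exact: le_lt_trans wr.
have cv : dotv (z - x0) (z - x0) @[z --> x] --> dotv (x - x0) (x - x0).
  exact: cvg_dotv_sq.
have e : x + t *: (u - x) @[t --> 0^'+] --> x.
  rewrite -[X in _ --> X]addr0; apply: cvgD; first exact: cvg_cst.
  rewrite -[X in _ --> X](scale0r (u - x)); apply: cvgZ; last exact: cvg_cst.
  exact: cvg_within.
(* A short step from [x] towards any [u] in [C] remains in the ball, so it is an admissible test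
   point. *)
have nb : \forall t \near 0^'+,
    dotv (x + t *: (u - x) - x0) (x + t *: (u - x) - x0) < r2.
  have hh := cvg_comp _ _ e cv; exact: (cvgr_lt _ hh).
have [t [t0 t1 ht]] : exists t : R, [/\ 0 < t, t <= 1 &
    dotv (x + t *: (u - x) - x0) (x + t *: (u - x) - x0) < r2].
  near (0:R)^'+ => t; exists t; split.
  - by near: t; exact: nbhs_right_gt.
  - by near: t; exact: nbhs_right_le.
  - by near: t.
have := VIx (x + t *: (u - x)).
rewrite addrAC subrr add0r dotvZr pmulr_rge0 //; apply; split.
  by apply: segC => //; rewrite t1 ltW.
exact: ltW.
Unshelve. all: by end_near. Qed.

End VIball.

(** * Differentials and Jacobians *)

Section Diff.
Context {R : realType}.

Lemma diff_eps (V W : normedModType R) (f : V -> W) (a : V) :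
  differentiable f a -> forall e, 0 < e ->
  \forall h \near 0, `|f (a + h) - f a - 'd f a h| <= e * `|h|.
Proof.
move=> /diff_locally df e e0.
have /eqoP/(_ e e0) : (f \o shift a - (cst (f a) + 'd f a)) =o_ 0 id.
  by rewrite {1}df [X in X - _]addrC addrK.
apply: filterS => h.
by rewrite /= !fctE /= opprD addrA [h + a]addrC.
Qed.

Lemma mulmx_continuous {q r} (D : 'M[R]_(r, q)) :
  continuous (mulmx D : 'cV[R]_q -> 'cV[R]_r).
Proof. by move=> x; apply: (cvg_mulmx (F := nbhs x)); exact: cvg_id. Qed.

Lemma linear_diff_of_eps (V W : normedModType R) (f : V -> W) (a : V)
    (D : {linear V -> W}) : continuous D ->
  (forall e, 0 < e -> \forall h \near 0, `|f (a + h) - f a - D h| <= e * `|h|) ->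
  differentiable f a /\ 'd f a = D :> (V -> W).
Proof.
move=> cD hf.
have fo : f \o shift a = cst (f a) + D +o_ 0 id.
  apply/eqaddoP => _/posnumP[e].
  have := hf e%:num; rewrite gt0 => /(_ isT); apply: filterS => h /=.
  by rewrite !fctE /= opprD addrA [h + a]addrC.
have dE := @diff_unique R _ _ f D a cD fo.
by split=> //; apply/diff_locallyP; rewrite dE.
Qed.

Lemma diff_of_eps {q r} (f : 'cV[R]_q -> 'cV[R]_r) (a : 'cV[R]_q) (D : 'M[R]_(r, q)) :
  (forall e : R, 0 < e ->
    \forall h \near (0 : 'cV[R]_q), `|f (a + h) - f a - D *m h| <= e * `|h|) ->
  differentiable f a /\ 'd f a = mulmx D :> ('cV[R]_q -> 'cV[R]_r).
Proof.
exact: (@linear_diff_of_eps 'cV[R]_q 'cV[R]_r f a (mulmx D) (@mulmx_continuous _ _ D)).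
Qed.

Lemma cV_sum_delta {q} (v : 'cV[R]_q) : v = \sum_j v j 0 *: delta_mx j 0.
Proof. by rewrite {1}[v]matrix_sum_delta; apply: eq_bigr => i _; rewrite big_ord1. Qed.

Lemma diff_jac {q r} (f : 'cV[R]_q -> 'cV[R]_r) a v :
  differentiable f a -> 'd f a v = jac f a *m v.
Proof.
move=> df; rewrite {1}(cV_sum_delta v) linear_sum /=; apply/colP => i.
rewrite summxE mxE; apply: eq_bigr => j _.
by rewrite linearZ /= !mxE deriveE // mulrC.
Qed.

Lemma diff_grad {q} (f : 'cV[R]_q -> R) a v :
  differentiable f a -> 'd f a v = dotv (grad f a) v.
Proof.
move=> df; rewrite {1}(cV_sum_delta v) linear_sum dotvE /=.
apply: eq_bigr => j _.
by rewrite linearZ /= !mxE deriveE // mulrC.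
Qed.

Lemma jac_of_diff {q r} (f : 'cV[R]_q -> 'cV[R]_r) a (D : 'M[R]_(r, q)) :
  differentiable f a -> 'd f a = mulmx D :> ('cV[R]_q -> 'cV[R]_r) -> jac f a = D.
Proof.
move=> df dE; apply/matrixP => i j; rewrite mxE deriveE // dE.
by rewrite -colE mxE.
Qed.

Section Partial.
Variables (V1 V2 W : normedModType R) (f : V1 * V2 -> W) (x : V1) (y : V2).
Hypothesis df : differentiable f (x, y).

Lemma differentiable_fst : differentiable (fun x' => f (x', y)) x.
Proof.
apply: (@differentiable_comp _ _ _ _ (fun x' => (x', y)) f) => //.
Qed.

Lemma diff_fst v : 'd (fun x' => f (x', y)) x v = 'd f (x, y) (v, 0).
Proof.
have dp : differentiable (fun x' => (x', y)) x by exact: differentiable_pair.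
rewrite (@diff_comp _ _ _ _ (fun x' => (x', y)) f) //=.
by rewrite diff_pair //= diff_cst (@diff_lin _ _ _ idfun) //; move=> z.
Qed.

Lemma differentiable_snd : differentiable (fun y' => f (x, y')) y.
Proof.
apply: (@differentiable_comp _ _ _ _ (fun y' => (x, y')) f) => //.
Qed.

Lemma diff_snd v : 'd (fun y' => f (x, y')) y v = 'd f (x, y) (0, v).
Proof.
have dp : differentiable (fun y' => (x, y')) y by exact: differentiable_pair.
rewrite (@diff_comp _ _ _ _ (fun y' => (x, y')) f) //=.
by rewrite diff_pair //= diff_cst (@diff_lin _ _ _ idfun) //; move=> z.
Qed.

End Partial.
End Diff.

(** * Nash equilibria as solutions of a variational inequality *)

Section FirstOrder.
Context {R : realType} {n : nat}.
Implicit Types (S : set 'cV[R]_n) (f : 'cV[R]_n -> R).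

(** The limit is one-sided because [x + h *: (u - x)] is known to be feasible only for [h] between 0
    and 1. *)
Lemma cvg_grad f x v : differentiable f x ->
  h^-1 * (f (x + h *: v) - f x) @[h --> 0^'+] --> dotv (grad f x) v.
Proof.
move=> df; rewrite -diff_grad // -deriveE //.
have := @diff_derivable _ _ _ f x v df; rewrite /derivable => dfc.
have -> : (fun h => h^-1 * (f (x + h *: v) - f x)) =
    (fun h => h^-1 *: ((f \o shift x) (h *: v) - f x)).
  by apply/funext => h /=; rewrite [h *: v + x]addrC.
apply: cvg_trans dfc; apply: cvg_app => A [e e0 Ae]; exists e => // h he h0.
by apply: Ae => //; exact: lt0r_neq0.
Qed.

Lemma minimizer_grad S f x u : segment_closed S -> S x -> S u ->
  (forall z, S z -> f x <= f z) -> differentiable f x ->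
  0 <= dotv (grad f x) (u - x).
Proof.
move=> segS Sx Su fmin df; have cg := cvg_grad (v := u - x) df; apply: (cvgr_to_ge cg).
near=> h.
have h0 : 0 < h by near: h; exact: nbhs_right_gt.
have h1 : h <= 1 by near: h; exact: nbhs_right_le.
rewrite pmulr_rge0 ?invr_gt0 // subr_ge0; apply: fmin; apply: segS => //.
by rewrite h1 ltW.
Unshelve. all: by end_near. Qed.

(** Convexity along the segment bounds the difference quotient at [x] by [f u - f x], and the bound
    passes to the limit. *)
Lemma strongly_convex_grad S f x u : strongly_convex S f -> S x -> S u ->
  differentiable f x -> f x + dotv (grad f x) (u - x) <= f u.
Proof.
move=> [alpha a0 cf] Sx Su df; rewrite -lerBrDl.
have cg := cvg_grad (v := u - x) df; apply: (cvgr_to_le cg); near=> h.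
have h0 : 0 < h by near: h; exact: nbhs_right_gt.
have h1 : h <= 1 by near: h; exact: nbhs_right_le.
rewrite ler_pdivrMl //.
have := cf u x Su Sx h; rewrite h1 ltW // => /(_ isT).
have -> : h *: u + (1 - h) *: x = x + h *: (u - x).
  by rewrite scalerBl scale1r scalerBr addrC -addrA [- _ + _]addrC.
have : 0 <= alpha / 2 * h * (1 - h) * dotv (u - x) (u - x).
  by rewrite !mulr_ge0 ?dotv_ge0 ?subr_ge0 ?invr_ge0 // ltW.
lra.
Unshelve. all: by end_near. Qed.

End FirstOrder.

(** * Polyhedra and stacked block constraints *)

Section Polyhedron.
Context {R : realType} {n m p : nat}.
Variables (B : 'M[R]_(m, n)) (b : 'cV[R]_m) (H : 'M[R]_(p, n)) (h : 'cV[R]_p).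

Lemma polyhedron_segment_closed : segment_closed (polyhedron B b H h).
Proof.
move=> x y t [Bx Hx] [By Hy] /andP[t0 t1]; split=> [i|].
  rewrite mulmxDr -scalemxAr mulmxBr.
  move: (B *m x) (B *m y) (Bx i) (By i) => u v ui vi; rewrite !mxE.
  have : 0 <= (1 - t) * (b i 0 - u i 0) by rewrite mulr_ge0 ?subr_ge0.
  have : 0 <= t * (b i 0 - v i 0) by rewrite mulr_ge0 ?subr_ge0.
  lra.
by rewrite mulmxDr -scalemxAr mulmxBr Hx Hy subrr scaler0 addr0.
Qed.

Lemma polyhedron_closed : closed (polyhedron B b H h).
Proof.
have cB q (A : 'M[R]_(q, n)) i : continuous (fun x : 'cV[R]_n => (A *m x) i 0).
  move=> x; apply: (mx_cvgP (F := nbhs x) _ _).1.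
  by apply: (cvg_mulmx (F := nbhs x)); exact: cvg_id.
have -> : polyhedron B b H h =
    (\bigcap_i [set x | 0 <= b i 0 - (B *m x) i 0]) `&`
    (\bigcap_i ([set x | 0 <= (H *m x) i 0 - h i 0] `&`
                [set x | 0 <= h i 0 - (H *m x) i 0])).
  apply/seteqP; split=> [x [Bx Hx]|x [Bx Hx]]; split.
  - by move=> i _ /=; rewrite subr_ge0.
  - by move=> i _ /=; rewrite Hx subrr.
  - by move=> i; have := Bx i I; rewrite /= subr_ge0.
  - apply/colP => i; have [/= h1 h2] := Hx i I.
    by apply/eqP; rewrite eq_le; apply/andP; split; rewrite -subr_ge0.
apply: closedI; apply: closed_bigI => i _; last apply: closedI;
  apply: closed_ge_fun => x; apply: (cvgB (F := nbhs x));
  do ?[exact: cvg_cst|exact: cB].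
Qed.

End Polyhedron.

Section Blocks.
Context {R : realType} {N n : nat}.

Lemma blkdiag_mul (r : 'I_N -> nat) (B : forall i, 'M[R]_(r i, n))
    (x : 'cV[R]_(\sum_(i < N) n)) :
  blkdiag B *m x = \mxcol_i (B i *m submxcol x i).
Proof.
rewrite /blkdiag mxblockEv mxcol_mul; apply: eq_mxcol => i.
rewrite -{1}(submxcolK x) mul_mxrow_mxcol (bigD1 i) //= eqxx.
by rewrite big1 ?addr0 // => j /negPf ji; rewrite eq_sym ji mul0mx.
Qed.

Lemma vle_mxcol (r : 'I_N -> nat) (u v : forall i, 'cV[R]_(r i)) :
  vle (\mxcol_i u i) (\mxcol_i v i) <-> forall i, vle (u i) (v i).
Proof.
split=> [h i l|h l]; last by rewrite !mxE; exact: h.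
have e (w : forall i, 'cV[R]_(r i)) : w i l 0 = submxcol (\mxcol_i w i) i l 0.
  by rewrite mxcolK.
by rewrite (e u) (e v) mxE [leRHS]mxE; exact: h.
Qed.

Lemma prodset_polyhedron (m p : 'I_N -> nat) (X : 'I_N -> set 'cV[R]_n)
  (B : forall i : 'I_N, 'M[R]_(m i, n)) (b : forall i : 'I_N, 'cV[R]_(m i))
  (H : forall i : 'I_N, 'M[R]_(p i, n)) (h : forall i : 'I_N, 'cV[R]_(p i)) :
  (forall i, X i = polyhedron (B i) (b i) (H i) (h i)) ->
  prodset X = polyhedron (blkdiag B) (\mxcol_i b i) (blkdiag H) (\mxcol_i h i).
Proof.
move=> XE; apply/seteqP; split=> x; rewrite /prodset /polyhedron /= !blkdiag_mul.
  move=> Xx; split.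
    by apply/vle_mxcol => i; have := Xx i; rewrite XE => -[].
  by apply/eq_mxcolP => i; have := Xx i; rewrite XE => -[].
by move=> [/vle_mxcol h1 /eq_mxcolP h2] i; rewrite XE; split.
Qed.

Lemma dotv_blocks (q : 'I_N -> nat) (u v : 'cV[R]_(\sum_(i < N) q i)) :
  dotv u v = \sum_i dotv (submxcol u i) (submxcol v i).
Proof.
rewrite /dotv -{1}(submxcolK u) -{1}(submxcolK v) tr_mxcol mul_mxrow_mxcol.
by rewrite summxE.
Qed.

End Blocks.

Section Nash.
Context {R : realType} {N n : nat} {d : 'I_N -> nat}.
Variables (P : 'M[R]_N)
  (J : forall i : 'I_N, 'cV[R]_n -> 'cV[R]_n -> 'cV[R]_(d i) -> R)
  (X : 'I_N -> set 'cV[R]_n) (y : 'cV[R]_(\sum_(i < N) d i)).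
Hypothesis segX : forall i, segment_closed (X i).

Definition own_cost x i := fun xi => J xi (aggregate P x i) (submxcol y i).

Hypothesis own_diff : forall i x, prodset X x ->
  differentiable (own_cost x i) (submxcol x i).
Hypothesis own_convex : forall i x, prodset X x ->
  strongly_convex (X i) (own_cost x i).

(** Forwards, the first order conditions of the players are summed over the blocks. Backwards, the
    VI is tested at unilateral deviations and convexity makes the first order condition
    sufficient. *)
Lemma nash_VI x : is_nash P J X y x <->
  solves_VI (prodset X) (fun x => game_op P J x y) x.
Proof.
split=> -[Xx h]; split=> //; [move=> u Xu|move=> i xi Xi].
  rewrite dotv_blocks sumr_ge0 // => i _.
  rewrite submxcolB /game_op mxcolK.
  exact: (minimizer_grad (segX (i := i)) (Xx i) (Xu i) (h i) (own_diff i Xx)).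
(* Only player [i] deviates, so every other block of [u - x] vanishes. *)
pose u := \mxcol_j (if j == i then xi else submxcol x j).
have uE j : submxcol u j = if j == i then xi else submxcol x j by rewrite mxcolK.
have Xu : prodset X u by move=> j; rewrite uE; case: eqVneq => [->|].
have := h _ Xu; rewrite dotv_blocks (bigD1 i) //= [X in _ + X]big1 ?addr0; last first.
  by move=> j /negPf ji; rewrite submxcolB uE ji subrr dotvC dotv0l.
rewrite submxcolB uE eqxx /game_op mxcolK => h0.
have := strongly_convex_grad (own_convex i Xx) (Xx i) Xi (own_diff i Xx).
by apply: le_trans; rewrite lerDl.
Qed.

End Nash.

(** * The linearized KKT system *)

(** The upper left block of the inverse of the saddle point matrix with rows [[D, A^T]] and
    [[A, 0]], when [D] and its Schur complement are invertible. *)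
Definition kkt_inv {R : realType} {k q : nat} (A : 'M[R]_(q, k)) (D : 'M[R]_k) : 'M[R]_k :=
  let L := invmx D in L - L *m A^T *m invmx (A *m L *m A^T) *m A *m L.

Section Saddle.
Context {R : realType} {k : nat}.

Definition posdef {l} (D : 'M[R]_l) := forall v : 'cV[R]_l, v != 0 -> 0 < dotv v (D *m v).

Lemma dotv_trmx {l} (D : 'M[R]_l) v : dotv v (D^T *m v) = dotv v (D *m v).
Proof. by rewrite dotv_mulmx trmxK dotvC. Qed.

Lemma posdef_unitmx {l} (D : 'M[R]_l) : posdef D -> D \in unitmx.
Proof.
move=> pd; rewrite -unitmx_tr -row_free_unit; apply/inj_row_free => v vD.
apply/eqP; rewrite -trmx_eq0; apply/negPn/negP => /pd.
by rewrite -[D]trmxK -trmx_mul vD trmx0 dotvC dotv0l ltxx.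
Qed.

Variable D : 'M[R]_k.
Hypothesis pdD : posdef D.

(** With [v = D *m u], the quadratic form of the inverse at [v] is that of [D] at [u]. *)
Lemma posdef_invmx : posdef (invmx D).
Proof.
have Du := posdef_unitmx pdD.
move=> v v0; rewrite -{1}[v](mulKVmx Du) dotvC; apply: pdD.
by apply: contra v0 => /eqP e; rewrite -[v](mulKVmx Du) e mulmx0.
Qed.

Variables (q : nat) (A : 'M[R]_(q, k)).
Hypothesis freeA : row_free A.

Lemma trmx_free_inj (v : 'cV[R]_q) : A^T *m v = 0 -> v = 0.
Proof.
have /row_freeP[A' AA'] := freeA; move=> /(congr1 (mulmx A'^T)).
by rewrite mulmx0 mulmxA -trmx_mul AA' trmx1 mul1mx.
Qed.

Local Notation L := (invmx D).

Lemma schur_unitmx : A *m L *m A^T \in unitmx.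
Proof.
apply: posdef_unitmx => v v0; rewrite -!mulmxA dotv_mulmx; apply: posdef_invmx.
by apply: contra v0 => /eqP/trmx_free_inj ->.
Qed.

Local Notation M := (kkt_inv A D).

(** Block elimination: the first equation expresses [u] through [s], and [A *m u = 0] then
    determines [s] by inverting the Schur complement. *)
Lemma saddle_solution (u w : 'cV[R]_k) (s : 'cV[R]_q) :
  D *m u + w + A^T *m s = 0 -> A *m u = 0 -> u = - (M *m w).
Proof.
have Du := posdef_unitmx pdD; move=> eq1 Au.
have uE : u = - (L *m w) - L *m A^T *m s.
  have /(congr1 (mulmx L)) := eq1.
  rewrite !mulmxDr mulKmx // mulmx0 mulmxA -addrA => /eqP.
  by rewrite addr_eq0 => /eqP ->; rewrite opprD.
have sE : s = - (invmx (A *m L *m A^T) *m A *m L *m w).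
  move: Au; rewrite uE mulmxBr mulmxN => /eqP; rewrite subr_eq0 => /eqP.
  move=> /(congr1 (mulmx (invmx (A *m L *m A^T)))).
  rewrite (mulmxA A (L *m A^T)) (mulmxA A L A^T) mulKmx ?schur_unitmx // => <-.
  by rewrite mulmxN !mulmxA.
by rewrite uE sE /kkt_inv mulmxBl opprB mulmxN opprK !mulmxA addrC.
Qed.

(** The vector [u = M *m v] solves [D *m u = v + A^T *m s] with [A *m u = 0]. Hence the term in [s]
    drops out of [<v, u>], which equals [<D *m u, u>]. *)
Lemma saddle_psd : psd M.
Proof.
have Du := posdef_unitmx pdD; move=> v _.
pose s := - (invmx (A *m L *m A^T) *m A *m L *m v).
have e : D *m (M *m v) = v + A^T *m s.
  rewrite /kkt_inv mulmxBl mulmxBr !mulmxA mulmxV // !mul1mx.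
  by rewrite /s mulmxN !mulmxA.
have AM : A *m (M *m v) = 0.
  rewrite /kkt_inv mulmxBl mulmxBr !mulmxA mulmxV ?schur_unitmx // mul1mx subrr //.
move: (M *m v) e AM => u e Au.
have -> : v = D *m u - A^T *m s by rewrite e addrK.
rewrite dotvBl -dotv_mulmx Au (dotvC s) dotv0l subr0 dotvC.
by have [->|/pdD/ltW//] := eqVneq u 0; rewrite dotv0l.
Qed.

(* A vector orthogonal to the kernel of [A] is [A^T *m (A'^T *m z)] for any right
   inverse [A'] of [A]. *)
Lemma orth_ker (A' : 'M[R]_(k, q)) z : A *m A' = 1%:M ->
  (forall v, A *m v = 0 -> dotv z v = 0) -> z = A^T *m (A'^T *m z).
Proof.
move=> AA' zv; apply/eqP; rewrite -subr_eq0; apply/eqP/dotv_eq0.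
set w := (X in dotv X _); rewrite {1}/w dotvBl mulmxA -trmx_mul -dotv_mulmx.
rewrite -dotvBr; apply: zv.
by rewrite mulmxBr !mulmxA AA' mul1mx subrr.
Qed.

End Saddle.

(** * Multipliers of the active constraints *)

Section KKT.
Context {R : realType} {k m p : nat}.
Variables (B : 'M[R]_(m, k)) (b : 'cV[R]_m) (H : 'M[R]_(p, k)) (h : 'cV[R]_p).
Local Notation X := (polyhedron B b H h).

Lemma active_rowsE x (v : 'cV[R]_k) i :
  (active_rows B b x *m v) i 0 = (B *m v) (enum_val i) 0.
Proof. by rewrite !mxE; apply: eq_bigr => j _; rewrite !mxE. Qed.

Lemma active_eq x (i : 'I_#|active B b x|) : (B *m x) (enum_val i) 0 = b (enum_val i) 0.
Proof. by have := enum_valP i; rewrite inE => /eqP. Qed.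

Lemma not_active x l : X x -> l \notin active B b x -> (B *m x) l 0 < b l 0.
Proof. by move=> [Bx _]; rewrite inE lt_neqAle => ->; exact: Bx. Qed.

(** Active constraints do not increase along [v]; inactive ones are strict at [x] and stay so for
    small [t] by continuity. *)
Lemma feasible_direction x v : X x -> vle (active_rows B b x *m v) 0 ->
  H *m v = 0 -> exists2 t, 0 < t & X (x + t *: v).
Proof.
move=> Xx Bv Hv.
have e : x + t *: v @[t --> 0^'+] --> x.
  rewrite -[X in _ --> X]addr0; apply: cvgD; first exact: cvg_cst.
  rewrite -[X in _ --> X](scale0r v); apply: cvgZ; last exact: cvg_cst.
  exact: cvg_within.
have nb : \forall t \near 0^'+, forall l, (B *m (x + t *: v)) l 0 <= b l 0.
  apply: filter_forall => l.
  have [la|la] := boolP (l \in active B b x).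
    near=> t; have t0 : 0 < t by near: t; exact: nbhs_right_gt.
    have := Bv (enum_rank_in la l); rewrite active_rowsE enum_rankK_in // [leRHS]mxE => Bvl.
    have := active_eq (enum_rank_in la l); rewrite enum_rankK_in // => Bxl.
    rewrite mulmxDr -scalemxAr; move: Bvl Bxl.
    move: (B *m x) (B *m v) => u w wl ul; rewrite !mxE ul gerDl.
    by rewrite pmulr_rle0.
  have hB : B *m (x + t *: v) @[t --> 0^'+] --> B *m x by exact: cvg_mulmx.
  have hl : (B *m (x + t *: v)) l 0 @[t --> 0^'+] --> (B *m x) l 0.
    exact: (mx_cvgP _ _).1 hB l 0.
  have : \forall t \near 0^'+, (B *m (x + t *: v)) l 0 < b l 0.
    by apply: (cvgr_lt _ hl); exact: not_active.
  by apply: filterS => t /ltW.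
near (0:R)^'+ => t; exists t; first by near: t; exact: nbhs_right_gt.
split; first by near: t.
by rewrite mulmxDr -scalemxAr Hv scaler0 addr0; case: Xx.
Unshelve. all: by end_near. Qed.

Lemma active_mx_mul0 x (v : 'cV[R]_k) : active_mx B b H x *m v = 0 ->
  active_rows B b x *m v = 0 /\ H *m v = 0.
Proof. by rewrite /active_mx mul_col_mx -[0]vsubmxK => /eq_col_mx; rewrite !linear0. Qed.

(** A right inverse of [A] gives the multiplier explicitly, in place of Farkas' lemma. Both signs of
    a vector of [ker A] are feasible directions, so [f x] is orthogonal to [ker A]. *)
Lemma VI_multiplier (f : 'cV[R]_k -> 'cV[R]_k) x (A' : 'M[R]_(k, #|active B b x| + p)) :
  let A := active_mx B b H x in
  let nu := - (A'^T *m f x) in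
  A *m A' = 1%:M -> solves_VI X f x ->
  f x = - (A^T *m nu) /\ forall i, 0 <= nu (lshift p i) 0.
Proof.
move=> A nu AA' [Xx VIx].
have dir v : vle (active_rows B b x *m v) 0 -> H *m v = 0 -> 0 <= dotv (f x) v.
  move=> Bv Hv; have [t t0 /VIx] := feasible_direction Xx Bv Hv.
  by rewrite addrAC subrr add0r dotvZr pmulr_rge0.
split.
  rewrite /nu mulmxN opprK; apply: orth_ker => // v.
  move=> /active_mx_mul0[Bv Hv]; apply/eqP; rewrite eq_le.
  rewrite dir ?Bv // andbT -oppr_ge0 -dotvNr dir // mulmxN ?Hv ?Bv ?oppr0 //.
(* The direction [- (A' *m e)] relaxes the [i]-th active constraint alone, and its product with
   [f x] is the [i]-th entry of [nu]. *)
move=> i; pose e : 'cV[R]_(#|active B b x| + p) := delta_mx (lshift p i) 0.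
have Ae : A *m (- (A' *m e)) = - e by rewrite mulmxN mulmxA AA' mul1mx.
have eE : - e = col_mx (- delta_mx i 0) 0.
  apply/colP => j; rewrite !mxE; case: splitP => l jl; rewrite !mxE.
    by rewrite -!val_eqE /= jl.
  by rewrite -val_eqE /= jl; case: eqP => [/eqP|]; rewrite ?oppr0 //= gtn_eqF // ltn_addr.
have [Bv Hv] : active_rows B b x *m (- (A' *m e)) = - delta_mx i 0 /\
     H *m (- (A' *m e)) = 0.
  by apply: eq_col_mx; rewrite -mul_col_mx -eE -Ae.
have := dir _ _ Hv; rewrite Bv => /(_ _)/le_trans -> //.
  by move=> j; rewrite !mxE; case: (_ && _); rewrite ?oppr0 ?lerN10.
rewrite dotvNr dotv_mulmx -dotvNl -/nu dotvE (bigD1 (lshift p i)) //= big1 ?addr0.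
  by rewrite [e _ _]mxE !eqxx mulr1.
by move=> j /negPf ji; rewrite [e _ _]mxE ji mulr0.
Qed.

(** Extends [nu] by zero to the inactive constraints, so that strict complementarity can be applied
    to it. *)
Lemma multiplier_KKT Fx x (nu : 'cV[R]_(#|active B b x| + p)) : X x ->
  Fx = - ((active_mx B b H x)^T *m nu) -> (forall i, 0 <= nu (lshift p i) 0) ->
  exists lam mu, is_KKT B b H h Fx x lam mu /\
    forall i, lam (enum_val i) 0 = nu (lshift p i) 0.
Proof.
move=> [Bx Hx] FE nu0.
pose E : 'M[R]_(#|active B b x|, m) := rowsub (fun i => enum_val i) 1%:M.
have EB : active_rows B b x = E *m B by rewrite /active_rows rowsubE.
have lamE i : (E^T *m usubmx nu) (enum_val i) 0 = nu (lshift p i) 0.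
  rewrite mxE (bigD1 i) //= big1 ?addr0 => [|j ji].
    by rewrite !mxE eqxx mul1r.
  by rewrite !mxE (inj_eq enum_val_inj) (negPf ji) mul0r.
exists (E^T *m usubmx nu), (dsubmx nu); split=> //; split=> //.
- rewrite FE mulmxA -trmx_mul -EB /active_mx tr_col_mx -{1}[nu]vsubmxK.
  by rewrite mul_row_col -addrA addrC subrr.
- rewrite trmx_mul trmxK -mulmxA.
  have -> : E *m (B *m x - b) = 0; last by rewrite mulmx0.
  apply/colP => i; rewrite mulmxBr mulmxA -EB -rowsubE.
  by rewrite mxE active_rowsE active_eq !mxE subrr.
- move=> l; rewrite !mxE sumr_ge0 // => i _.
  by rewrite !mxE mulr_ge0 ?ler0n //; exact: nu0.
Qed.

(** The constraints active at [x] also hold with equality at [x']. So for feasible [u],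
    [A *m (u - x')] is nonpositive in the inequality rows and zero in the others. *)
Lemma multiplier_VI (f : 'cV[R]_k -> 'cV[R]_k) x x' (nu : 'cV[R]_(#|active B b x| + p)) :
  X x -> X x' -> active_mx B b H x *m x' = active_mx B b H x *m x ->
  f x' = - ((active_mx B b H x)^T *m nu) -> (forall i, 0 <= nu (lshift p i) 0) ->
  solves_VI X f x'.
Proof.
move=> Xx Xx' Axx fE nu0; split=> // u [Bu Hu].
rewrite fE dotvNl -dotv_mulmx oppr_ge0 mulmxBr Axx -mulmxBr.
rewrite dotvE big_split_ord /=.
rewrite [X in _ + X]big1 ?addr0 => [|i _]; last first.
  rewrite /active_mx mul_col_mx col_mxEd mulmxBr Hu.
  by case: Xx => _ ->; rewrite subrr mxE mulr0.
rewrite sumr_le0 // => i _; rewrite mulr_ge0_le0 //.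
rewrite /active_mx mul_col_mx col_mxEu active_rowsE mulmxBr mxE [X in _ + X]mxE.
by rewrite active_eq subr_le0; exact: Bu.
Qed.

End KKT.

(** * The local solution map *)

Section JacobianMonotone.
Context {R : realType}.

Lemma is_derive_dotv {k} (psi : R -> 'cV[R]_k) (w : 'cV[R]_k) (t : R) :
  derivable psi t 1 -> is_derive t 1 (fun s => dotv (psi s) w) (dotv ('D_1 psi t) w).
Proof.
move=> dpsi.
have c : h^-1 *: (((fun s => dotv (psi s) w) \o shift t) (h *: 1) - dotv (psi t) w)
    @[h --> 0^'] --> dotv ('D_1 psi t) w.
  have -> : (fun h : R => h^-1 *: (((fun s => dotv (psi s) w) \o shift t) (h *: 1)
       - dotv (psi t) w)) =
      (fun h => dotv (h^-1 *: ((psi \o shift t) (h *: 1) - psi t)) w).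
    by apply/funext => h /=; rewrite dotvZl dotvBl.
  by apply: cvg_dotv; [exact: dpsi|exact: cvg_cst].
by apply: DeriveDef; [exact: (cvgP _ c)|exact: (cvg_lim _ c)].
Qed.

(** Mean value theorem for the scalar function [<f (x2 + t w), w>] with [w = x1 - x2]. *)
Lemma smono_of_jac {k} (C : set 'cV[R]_k) (f : 'cV[R]_k -> 'cV[R]_k) c :
  segment_closed C -> (forall x, C x -> differentiable f x) ->
  (forall x v, C x -> c * dotv v v <= dotv v (jac f x *m v)) -> smono c C f.
Proof.
move=> segC df cf x1 x2 C1 C2; pose w : 'cV[R]_k := x1 - x2.
pose line (t : R) : 'cV[R]_k := x2 + t *: w.
have Cl (t : R) : 0 <= t <= 1 -> C (line t) by exact: segC.
have dl (t : R) : is_diff t line (fun s => s *: w).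
  have : is_diff t (cst x2 + ( *:%R^~ w)) (0 + ( *:%R^~ w)) by exact: is_diffD.
  by rewrite add0r.
have [dline lineE] : (forall t, differentiable line t) /\
    (forall t s, 'd line t s = s *: w).
  by split=> t; [exact: ex_diff|move=> s; rewrite diff_val].
pose phi t := dotv (f (line t)) w.
have dphi (t : R) : 0 <= t <= 1 -> is_derive t 1 phi (dotv ('d f (line t) w) w).
  move=> t01.
  have dfl : differentiable (f \o line) t.
    by apply: differentiable_comp => //; apply/df/Cl.
  have -> : 'd f (line t) w = 'D_1 (f \o line) t.
    rewrite deriveE // (@diff_comp _ _ _ _ line f) //=; last by apply/df/Cl.
    by rewrite lineE scale1r.
  by apply: is_derive_dotv; exact: diff_derivable.
have [||z z01 zE] := @MVT R phi (fun t => dotv ('d f (line t) w) w) 0 1 ltr01.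
- move=> t; rewrite in_itv /= => /andP[t0 t1]; apply: dphi.
  by rewrite !ltW.
- apply: continuous_in_subspaceT => t; rewrite inE /= in_itv /= => t01.
  apply: differentiable_continuous; apply/derivable1_diffP.
  exact: (@ex_derive _ _ _ _ _ _ _ (dphi t t01)).
have e1 : phi 1 - phi 0 = dotv (f x1 - f x2) w.
  have l1 : line 1 = x1 by rewrite /line scale1r /w addrC subrK.
  have l0 : line 0 = x2 by rewrite /line scale0r addr0.
  by rewrite /phi l1 l0 dotvBl.
move: zE; rewrite e1 subr0 mulr1 => ->.
have z01' : 0 <= z <= 1.
  by move: z01; rewrite in_itv /= => /andP[? ?]; rewrite !ltW.
rewrite diff_jac; last by apply/df/Cl.
by rewrite dotvC; apply/cf/Cl.
Qed.

Lemma quad_perturb {k} (D D' : 'M[R]_k) (e : R) v :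
  (forall i j, `|D i j - D' i j| <= e) ->
  dotv v (D *m v) - dotv v (D' *m v) <= e * (k * k)%:R * dotv v v.
Proof.
move=> h; rewrite -dotvBr -mulmxBl dotvE.
have vle i : `|v i 0| ^+ 2 <= dotv v v.
  apply: le_trans (normr_sqr_le_dotv v); rewrite lerXn2r ?nnegrE //.
  exact: coord_le_normr.
have vvle i j : `|v i 0| * `|v j 0| <= dotv v v.
  have := vle i; have := vle j; have := sqr_ge0 (`|v i 0| - `|v j 0|); nra.
have -> : e * (k * k)%:R * dotv v v = \sum_(i < k) \sum_(j < k) e * dotv v v.
  by rewrite sumr_const card_ord sumr_const card_ord -mulrnA mulrAC mulr_natr.
apply: ler_sum => i _; rewrite mxE mulr_sumr; apply: ler_sum => j _.
apply: le_trans (ler_norm _) _; rewrite !normrM !mxE.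
rewrite mulrCA; apply: ler_pM => //; exact: mulr_ge0.
Qed.

End JacobianMonotone.

Section NearPosdef.
Context {R : realType} {k q : nat}.
Variables (F : 'cV[R]_k -> 'cV[R]_q -> 'cV[R]_k).
Variables (S : set ('cV[R]_k * 'cV[R]_q)) (xb : 'cV[R]_k) (yb : 'cV[R]_q) (alpha : R).
Local Notation G := (fun w : 'cV[R]_k * 'cV[R]_q => F w.1 w.2).
Hypothesis C1 : Ck_on 1 G S.
Hypothesis Sb : S (xb, yb).

Lemma jac_fstE x y i j : differentiable G (x, y) ->
  jac (fun x => F x y) x i j = ('D_(delta_mx j 0, 0) G (x, y)) i 0.
Proof.
move=> dG; rewrite mxE deriveE; last exact: (differentiable_fst dG).
by rewrite (diff_fst dG) deriveE.
Qed.

(** The entries of the Jacobian are continuous on an open set around the pair, so half of [alpha]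
    survives nearby, including at parameters outside the original set. *)
Lemma near_posdef : 0 < alpha ->
  (forall v, alpha * dotv v v <= dotv v (jac (fun x => F x yb) xb *m v)) ->
  \forall w \near (xb, yb), differentiable G w /\
    forall v, alpha / 2 * dotv v v <= dotv v (jac (fun x => F x w.2) w.1 *m v).
Proof.
move=> a0 pd; have [U [oU SU [dU cU]]] := C1.
have Ub := SU _ Sb.
(* Makes the loss [e * (k * k)] from [quad_perturb] at most [alpha / 2]; the added 1 covers
   [k = 0]. *)
pose e := alpha / 2 / ((k * k)%:R + 1).
have k0 : 0 < (k * k)%:R + 1 :> R by rewrite ltr_wpDl.
have e0 : 0 < e by rewrite !divr_gt0.
have nU : \forall w \near (xb, yb), U w by exact: open_nbhs_nbhs.
have nD : \forall w \near (xb, yb), forall i j,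
    `|('D_(delta_mx j 0, 0) G (xb, yb)) i 0 - ('D_(delta_mx j 0, 0) G w) i 0| <= e.
  apply: (filter_forall (F := nbhs (xb, yb))) => i.
  apply: (filter_forall (F := nbhs (xb, yb))) => j.
  have c : 'D_(delta_mx j 0, 0) G w @[w --> (xb, yb)] -->
      'D_(delta_mx j 0, 0) G (xb, yb) by exact: cU.
  have c' : ('D_(delta_mx j 0, 0) G w) i 0 @[w --> (xb, yb)] -->
      ('D_(delta_mx j 0, 0) G (xb, yb)) i 0 by exact: (mx_cvgP _ _).1 c i 0.
  by move/cvgrPdist_le: c' => /(_ e e0).
near=> w.
have Uw : U w by near: w.
split; first exact: dU.
move=> v.
have dw : differentiable G (w.1, w.2) by rewrite -surjective_pairing; exact: dU.
have db : differentiable G (xb, yb) by exact: dU.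
have h : forall i j,
    `|('D_(delta_mx j 0, 0) G (xb, yb)) i 0 - ('D_(delta_mx j 0, 0) G w) i 0| <= e.
  by near: w.
have := @quad_perturb R k (jac (fun x => F x yb) xb) (jac (fun x => F x w.2) w.1) e v.
have hh i j : `|jac (fun x => F x yb) xb i j - jac (fun x => F x w.2) w.1 i j| <= e.
  by rewrite !jac_fstE //; have := h i j; rewrite -surjective_pairing.
move=> /(_ hh); have := pd v.
have : e * (k * k)%:R * dotv v v <= alpha / 2 * dotv v v.
  rewrite ler_wpM2r ?dotv_ge0 // /e -mulrA ler_piMr //; first by rewrite divr_ge0 // ltW.
  by rewrite ler_pdivrMl // mulr1 lerDl.
lra.
Unshelve. all: by end_near. Qed.

Lemma near_prod_eball (Q : 'cV[R]_k * 'cV[R]_q -> Prop) : (\forall w \near (xb, yb), Q w) ->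
  exists2 r2 : R, 0 < r2 & \forall y \near yb, forall x, eball xb r2 x -> Q (x, y).
Proof.
move=> [[A1 A2] /= [/nbhs_ballP[e e0 He] n2] sub].
exists ((e / 2) ^+ 2); first by rewrite exprn_gt0 // divr_gt0.
near=> y => x; rewrite /eball /= => Hx; apply: sub; split=> /=; last by near: y.
apply: He; rewrite -ball_normE /= distrC.
have h := le_trans (normr_sqr_le_dotv _) Hx.
have : `|x - xb| <= e / 2.
  by rewrite -(@ler_pXn2r _ 2) // ?nnegrE // divr_ge0 // ltW.
by move=> h2; apply: le_lt_trans h2 _; rewrite ltr_pdivrMr // ltr_pMr // ltr1n.
Unshelve. all: by end_near. Qed.

End NearPosdef.

Lemma mulmx_norm_bound {R : realType} {k q} (M : 'M[R]_(q, k)) :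
  exists2 c, 0 < c & forall v : 'cV[R]_k, `|M *m v| <= c * `|v|.
Proof.
exact: (@linear_lipschitz R 'cV[R]_k 'cV[R]_q (mulmx M) (@mulmx_continuous _ _ _ M)).
Qed.

Lemma near_add0 {R : realType} {V : normedModType R} (P : V -> Prop) (y : V) :
  (\forall z \near y, P z) -> \forall h \near 0, P (y + h).
Proof.
move=> nP; have c : y + h @[h --> 0] --> y.
  rewrite -[X in _ --> X]addr0; apply: (cvgD (F := nbhs 0)); first exact: cvg_cst.
  exact: cvg_id.
exact: (c _ nP).
Qed.

Section SolutionMap.
Context {R : realType} {k q l : nat}.
Variables (F : 'cV[R]_k -> 'cV[R]_q -> 'cV[R]_k) (A : 'M[R]_(l, k)).
Variables (xb : 'cV[R]_k) (c r2 : R).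
Local Notation G := (fun w : 'cV[R]_k * 'cV[R]_q => F w.1 w.2).
Hypothesis c0 : 0 < c.
Variable A' : 'M[R]_(k, l).
Hypothesis AA' : A *m A' = 1%:M.

(** Collects what the local analysis needs from [F] at [y], without requiring [y] to be an
    admissible parameter. *)
Definition regular_at y := forall x, eball xb r2 x -> differentiable G (x, y) /\
  forall v, c * dotv v v <= dotv v (jac (fun x => F x y) x *m v).

(* The VI over the affine space [A *m x = A *m xb], whose tangent space is [ker A],
   with the solution required to stay near [xb]. *)
Definition eq_solution y x := [/\ A *m x = A *m xb, eball xb r2 x &
  forall v, A *m v = 0 -> dotv (F x y) v = 0].

Lemma regular_smono y : regular_at y -> smono c (eball xb r2) (fun x => F x y).
Proof.
move=> gy; apply: smono_of_jac => [|x /gy[dG _]|x v /gy[_]].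
- exact: eball_segment_closed.
- exact: (differentiable_fst dG).
- exact.
Qed.

(** The difference [x - x1] lies in [ker A], so it is orthogonal to both [F x y] and [F x1 y1].
    Strong monotonicity at [y] leaves only the change of [F x1] between the two parameters. *)
Lemma eq_solution_stable y y1 x x1 : regular_at y ->
  eq_solution y x -> eq_solution y1 x1 ->
  c ^+ 2 * dotv (x - x1) (x - x1) <=
    dotv (F x1 y - F x1 y1) (F x1 y - F x1 y1).
Proof.
move=> /regular_smono mono [Ax Bx ox] [Ax1 Bx1 ox1].
have Ad : A *m (x - x1) = 0 by rewrite mulmxBr Ax Ax1 subrr.
have h1 := mono _ _ Bx Bx1; rewrite (dotvBl (F x y)) (ox _ Ad) in h1.
set w := F x1 y - F x1 y1.
have wE : dotv w (x - x1) = dotv (F x1 y) (x - x1).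
  by rewrite dotvBl (ox1 _ Ad) subr0.
have := dotv_young c (- w) (x - x1); rewrite !dotvNl dotvNr opprK wE.
have := ler_wpM2l (ltW c0) h1; lra.
Qed.

Lemma eq_solution_exists y yb : regular_at y -> eq_solution yb xb ->
  dotv (F xb y - F xb yb) (F xb y - F xb yb) < c ^+ 2 * r2 ->
  exists x, eq_solution y x.
Proof.
move=> gy [_ _ ob] wlt.
(* The affine space is a polyhedron with no inequality rows. As [F xb yb] is orthogonal to [ker A],
   [VI_ball] applies with the small vector [F xb y - F xb yb]. *)
pose C := polyhedron (0 : 'M[R]_(0, k)) 0 A (A *m xb).
have CE x : C x <-> A *m x = A *m xb by split=> [[]//|h]; split=> // -[].
have [x [Cx VIx] est] : exists2 x, solves_VI C (fun x => F x y) x &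
    c ^+ 2 * dotv (x - xb) (x - xb) <=
    dotv (F xb y - F xb yb) (F xb y - F xb yb).
  apply: (@VI_ball R k C (fun x => F x y) xb (F xb y - F xb yb) c r2) => //.
  - exact: polyhedron_closed.
  - exact: polyhedron_segment_closed.
  - exact/CE.
  - by move=> x1 x2 [_ h1] [_ h2]; exact: regular_smono.
  - move=> x _ /gy[dG _]; apply: differentiable_continuous.
    exact: (differentiable_fst dG).
  - move=> x /CE Cx; rewrite dotvBl ob ?subr0 //.
    by rewrite mulmxBr Cx subrr.
exists x; split; first exact/CE.
  rewrite /eball /= -(@ler_pM2l _ (c ^+ 2)) ?exprn_gt0 //.
  exact: le_trans est (ltW wlt).
move=> v Av; apply/eqP; rewrite eq_le -oppr_ge0 -dotvNr.
have ge0 u : A *m u = 0 -> 0 <= dotv (F x y) u.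
  move=> Au; have /VIx : C (x + u).
    by apply/CE; rewrite mulmxDr Au addr0; exact/CE.
  by rewrite addrAC subrr add0r.
by rewrite !ge0 // mulmxN Av oppr0.
Qed.

(** A choice of solution, with default [xb] where there is none. At a regular [y],
    [eq_solution_stable] leaves at most one candidate. *)
Definition solution_map y := xget xb [set x | eq_solution y x].
Local Notation g := solution_map.

Lemma solution_mapP y : (exists x, eq_solution y x) -> eq_solution y (g y).
Proof. exact: xgetPex. Qed.

Lemma solution_map_lipschitz y1 :
  (\forall y \near y1, regular_at y /\ eq_solution y (g y)) ->
  exists2 K, 0 < K & \forall h \near (0 : 'cV[R]_q),
    `|g (y1 + h) - g y1| <= K * `|h|.
Proof.
move=> ny; have [gy1 sol1] := nbhs_singleton ny.
have [_ Bx1 _] := sol1; have [dG _] := gy1 _ Bx1.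
have dF := differentiable_snd dG; set E := jac (F (g y1)) y1.
have [CE CE0 hE] := mulmx_norm_bound E.
have k0 : 0 < k%:R + 1 :> R by rewrite ltr_wpDl.
(* [CE + 1] bounds the increment of [F (g y1)] near [y1], [1 / c] comes from stability, and [k + 1]
   replaces the root of [k] in passing from the Euclidean to the sup norm. *)
exists ((k%:R + 1) / c * (CE + 1)); first by rewrite !mulr_gt0 ?invr_gt0 // addr_gt0.
have ny' : \forall h \near (0 : 'cV[R]_q), regular_at (y1 + h) /\
    eq_solution (y1 + h) (g (y1 + h)).
  exact: near_add0 ny.
have nE := diff_eps dF ltr01.
near=> h.
have [gyh solh] : regular_at (y1 + h) /\ eq_solution (y1 + h) (g (y1 + h)).
  by near: h.
have Dlt : `|F (g y1) (y1 + h) - F (g y1) y1| <= (CE + 1) * `|h|.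
  have : `|F (g y1) (y1 + h) - F (g y1) y1 - 'd (F (g y1)) y1 h| <= 1 * `|h|.
    by near: h.
  rewrite diff_jac // -/E mul1r => h1.
  have := ler_normD (F (g y1) (y1 + h) - F (g y1) y1 - E *m h) (E *m h).
  by rewrite subrK mulrDl mul1r; have := hE h; lra.
have := eq_solution_stable gyh solh sol1.
move: (g (y1 + h) - g y1) (F (g y1) (y1 + h) - F (g y1) y1) Dlt => u w wlt est.
have h1 : (c * `|u|) ^+ 2 <= ((k%:R + 1) * ((CE + 1) * `|h|)) ^+ 2.
  rewrite exprMn; apply: le_trans (_ : c ^+ 2 * dotv u u <= _).
    by rewrite ler_pM2l ?exprn_gt0 //; exact: normr_sqr_le_dotv.
  apply: le_trans est _; apply: le_trans (dotv_le_normr_sqr w) _.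
  rewrite exprMn; apply: ler_pM => //.
    rewrite expr2; apply: le_trans (_ : 1 * (k%:R + 1) <= _).
      by rewrite mul1r lerDl.
    by rewrite ler_wpM2r ?(ltW k0) // lerDr.
  by rewrite ler_pXn2r // ?nnegrE // mulr_ge0 // addr_ge0 // ltW.
rewrite ler_pXn2r // ?nnegrE in h1; last 2 first.
- by rewrite mulr_ge0 // ltW.
- by rewrite !mulr_ge0 // ?addr_ge0 // ltW.
rewrite -(ler_pM2l c0); apply: le_trans h1 _.
by rewrite le_eqVlt; apply/orP; left; apply/eqP; field; rewrite gt_eqF.
Unshelve. all: by end_near. Qed.

(** The increment of [F] is [D *m u + E *m h + z] and lies in the range of [A^T], so the saddle
    system gives [u] up to [M *m z]. The Lipschitz bound on [u] makes [z] negligible with respect to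
    [h]. *)
Lemma solution_map_diff y1 :
  (\forall y \near y1, regular_at y /\ eq_solution y (g y)) ->
  let D := jac (fun x => F x y1) (g y1) in let E := jac (F (g y1)) y1 in
  differentiable g y1 /\ 'd g y1 = mulmx (- (kkt_inv A D *m E)) :> (_ -> _).
Proof.
move=> ny D E; have [gy1 sol1] := nbhs_singleton ny.
have [Ax1 Bx1 ox1] := sol1; have [dG pdD] := gy1 _ Bx1.
have pd : posdef D.
  by move=> v v0; apply: lt_le_trans (pdD v); rewrite mulr_gt0 // dotv_gt0.
have freeA : row_free A by apply/row_freeP; exists A'.
have [CM CM0 hM] := mulmx_norm_bound (kkt_inv A D).
have [K K0 lip] := solution_map_lipschitz ny.
have ny' : \forall h \near (0 : 'cV[R]_q), regular_at (y1 + h) /\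
    eq_solution (y1 + h) (g (y1 + h)).
  exact: near_add0 ny.
apply: diff_of_eps => e e0.
(* Compensates the norm bound [CM] of [kkt_inv A D] and the factor [K + 1] bounding [(u, h)] by
   [h]. *)
pose e1 := e / (CM * (K + 1)).
have K10 : 0 < K + 1 by rewrite addr_gt0.
have e10 : 0 < e1 by rewrite divr_gt0 // mulr_gt0.
have /nbhs_ballP[r /= r0 Hr] := diff_eps dG e10.
have nr : \forall h \near (0 : 'cV[R]_q), `|h| < r / (K + 1).
  apply/nbhs_ballP; exists (r / (K + 1)); first by rewrite /= divr_gt0.
  by move=> h; rewrite -ball_normE /= sub0r normrN.
near=> h.
have [gyh [Axh Bxh oxh]] : regular_at (y1 + h) /\ eq_solution (y1 + h) (g (y1 + h)).
  by near: h.
have lh : `|g (y1 + h) - g y1| <= K * `|h| by near: h.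
have hr : `|h| < r / (K + 1) by near: h.
set u := g (y1 + h) - g y1 in lh *.
have uh : `|(u, h)| <= (K + 1) * `|h|.
  rewrite prod_normE /= ge_max mulrDl mul1r.
  by rewrite (le_trans lh) ?lerDl // lerDr mulr_ge0 // ltW.
have /Hr : ball (0 : 'cV[R]_k * 'cV[R]_q) r (u, h).
  rewrite -ball_normE /= sub0r normrN; apply: le_lt_trans uh _.
  by rewrite mulrC -ltr_pdivlMr.
rewrite /= [g y1 + u]addrC subrK.
set z := F _ _ - _ - _ => zle.
have dE : 'd G (g y1, y1) (u, h) = D *m u + E *m h.
  have -> : (u, h) = (u, 0) + (0, h) by congr (_, _); rewrite ?addr0 ?add0r.
  rewrite linearD -(diff_fst dG) -(diff_snd dG) !diff_jac //.
    exact: (differentiable_snd dG).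
  exact: (differentiable_fst dG).
have oz : D *m u + (E *m h + z) = A^T *m (A'^T *m (D *m u + (E *m h + z))).
  apply: orth_ker => // v Av; rewrite addrA -dE addrC /z subrK.
  by rewrite dotvBl oxh // ox1 // subrr.
have Au : A *m u = 0 by rewrite /u mulmxBr Axh Ax1 subrr.
have uE : u = - (kkt_inv A D *m (E *m h + z)).
  apply: (saddle_solution pd freeA (s := - (A'^T *m (D *m u + (E *m h + z))))) => //.
  by rewrite mulmxN -oz subrr.
rewrite {1}uE mulNmx opprK mulmxDr mulmxA opprD addrAC addNr add0r normrN.
apply: le_trans (hM z) _; apply: le_trans (_ : CM * (e1 * ((K + 1) * `|h|)) <= _).
  rewrite ler_pM2l //; apply: le_trans zle _; by rewrite ler_pM2l.
rewrite le_eqVlt; apply/orP; left; apply/eqP; rewrite /e1; field.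
by rewrite !gt_eqF.
Unshelve. all: by end_near. Qed.

End SolutionMap.

(** A matrix and its symmetric part have the same quadratic form. *)
Lemma psd_shift {R : realType} {k} (D : 'M[R]_k) alpha :
  psd (2^-1 *: (D + D^T) - alpha%:M) ->
  forall v, alpha * dotv v v <= dotv v (D *m v).
Proof.
move=> h v; have [->|v0] := eqVneq v 0; first by rewrite !dotv0l mulr0.
have := h v v0; rewrite mulmxBl mul_scalar_mx -scalemxAl mulmxDl.
rewrite dotvBr !dotvZr dotvDr dotv_trmx; lra.
Qed.

(** * Existence, uniqueness and sensitivity for the inequality over a polyhedron *)

Section Sensitivity.
Context {R : realType} {k m p q : nat}.
Variables (B : 'M[R]_(m, k)) (b : 'cV[R]_m) (H : 'M[R]_(p, k)) (h : 'cV[R]_p).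
Local Notation X := (polyhedron B b H h).
Variables (Y : set 'cV[R]_q) (F : 'cV[R]_k -> 'cV[R]_q -> 'cV[R]_k).
Hypothesis FC1 : Ck_on 1 (fun w : 'cV[R]_k * 'cV[R]_q => F w.1 w.2) (X `*` Y).
Hypothesis Fmono : forall y, Y y -> strongly_monotone X (fun x => F x y).

Lemma VI_exists_unique x0 y : X x0 -> Y y -> exists! x, solves_VI X (fun x => F x y) x.
Proof.
move=> X0 Yy; have [alpha a0 [mono _]] := Fmono Yy.
have [U [_ SU [dU _]]] := FC1.
have Fcont x : X x -> {for x, continuous (fun x => F x y)}.
  move=> Xx; apply: differentiable_continuous.
  by have /differentiable_fst := dU _ (SU (x, y) (conj Xx Yy)).
have [x VIx _] : exists2 x, solves_VI X (fun x => F x y) x &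
    alpha ^+ 2 * dotv (x - x0) (x - x0) <= dotv (F x0 y) (F x0 y).
  (* The squared radius exceeds [|F x0 y|^2 / alpha^2], beyond which strong monotonicity admits no
     solution. *)
  apply: (@VI_ball R k X (fun x => F x y) x0 (F x0 y) alpha
    (dotv (F x0 y) (F x0 y) / alpha ^+ 2 + 1)) => //.
  - exact: polyhedron_closed.
  - exact: polyhedron_segment_closed.
  - by move=> x1 x2 [h1 _] [h2 _]; exact: mono.
  - by move=> x Xx _; exact: Fcont.
  - rewrite mulrDr mulr1 mulrC divfK ?gt_eqF ?exprn_gt0 //.
    by rewrite ltrDl exprn_gt0.
by exists x; split=> // x' VIx'; exact: VI_unique a0 mono VIx VIx'.
Qed.

Variables (xstar : 'cV[R]_q -> 'cV[R]_k) (yb : 'cV[R]_q).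
Hypothesis VIxstar : forall y, Y y -> solves_VI X (fun x => F x y) (xstar y).
Hypothesis Yb : Y yb.
Local Notation xb := (xstar yb).
Local Notation A := (active_mx B b H xb).
Hypothesis freeA : row_free A.
Hypothesis strict_compl : forall lam mu, is_KKT B b H h (F xb yb) xb lam mu ->
  forall l, (B *m xb) l 0 = b l 0 -> 0 < lam l 0.
Local Notation D := (jac (fun x => F x yb) xb).
Local Notation E := (jac (F xb) yb).

Lemma VI_sensitivity : posdef D /\ loc_diff_jac Y xstar yb (- kkt_inv A D *m E).
Proof.
have [alpha a0 [_ jacpos]] := Fmono Yb.
have VIb := VIxstar Yb; have [Xb _] := VIb.
have pd v : alpha * dotv v v <= dotv v (D *m v) by exact: psd_shift (jacpos _ Xb) v.
have posD : posdef D.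
  by move=> v v0; apply: lt_le_trans (pd v); rewrite mulr_gt0 // dotv_gt0.
split=> //.
have /row_freeP[A' AA'] := freeA.
have [FE nu0] := VI_multiplier AA' VIb.
have [lam [mu [kkt lamE]]] := multiplier_KKT Xb FE nu0.
have nupos i : 0 < (- (A'^T *m F xb yb)) (lshift p i) 0.
  by rewrite -lamE; apply: (strict_compl kkt); exact: active_eq.
have [r2 r20 nreg] := near_prod_eball (near_posdef FC1 (conj Xb Yb : (X `*` Y) (xb, yb)) a0 pd).
pose c := alpha / 2; have c0 : 0 < c by rewrite divr_gt0.
pose g := solution_map F A xb r2.
have solb : eq_solution F A xb r2 yb xb.
  split=> //; first by rewrite /eball /= subrr dotv0l ltW.
  by move=> v Av; rewrite FE dotvNl -dotv_mulmx Av dotvC dotv0l oppr0.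
have regb := nbhs_singleton nreg.
have dGb : differentiable (fun w : 'cV[R]_k * 'cV[R]_q => F w.1 w.2) (xb, yb).
  by have [_ /regb[]] := solb.
have nsol : \forall y \near yb, regular_at F xb c r2 y /\ eq_solution F A xb r2 y (g y).
  have cF : F xb y @[y --> yb] --> F xb yb.
    exact: differentiable_continuous (differentiable_snd dGb).
  have cw : F xb y - F xb yb @[y --> yb] --> (0 : 'cV[R]_k).
    rewrite -(subrr (F xb yb)).
    by apply: (cvgB (F := nbhs yb)) => //; exact: cvg_cst.
  have cd : dotv (F xb y - F xb yb) (F xb y - F xb yb) @[y --> yb] --> (0 : R).
    rewrite -(dotv0l (0 : 'cV[R]_k)).
    exact: (cvg_dotv (F := nbhs yb)).
  have nlt : \forall y \near yb,
      dotv (F xb y - F xb yb) (F xb y - F xb yb) < c ^+ 2 * r2.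
    by apply: (cvgr_lt _ cd); rewrite mulr_gt0 // exprn_gt0.
  near=> y; have ry : regular_at F xb c r2 y by near: y.
  split=> //; apply: solution_mapP.
  apply: (eq_solution_exists c0 ry solb); by near: y.
(* Stability between two solutions at the same parameter [yb] forces them to coincide. *)
have gb : g yb = xb.
  have [ry sy] := nbhs_singleton nsol.
  have := eq_solution_stable c0 ry sy solb.
  rewrite subrr dotv0l pmulr_rle0 ?exprn_gt0 // => le0.
  apply/eqP; rewrite -subr_eq0; apply/eqP/dotv_eq0/eqP.
  by rewrite eq_le le0 dotv_ge0.
have [dg dgE] := solution_map_diff c0 AA' nsol.
exists g; split.
(* The hypothesis of [solution_map_diff] is itself local, so it holds around every [y] near [yb]. *)
- have nn := near_join nsol; near=> y.
  have ny : \forall y' \near y, regular_at F xb c r2 y' /\ eq_solution F A xb r2 y' (g y').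
    by near: y.
  by have [] := solution_map_diff c0 AA' ny.
- have cg : g y @[y --> yb] --> xb.
    by rewrite -gb; exact: differentiable_continuous dg.
  have cFg : F (g y) y @[y --> yb] --> F xb yb.
    have cp : (g y, y) @[y --> yb] --> (xb, yb).
      have ci : y @[y --> yb] --> yb by exact: cvg_id.
      exact: (cvg_pair cg ci).
    exact: (cvg_comp _ _ cp (differentiable_continuous dGb)).
  have nnu : \forall y \near yb, forall i, 0 < (- (A'^T *m F (g y) y)) (lshift p i) 0.
    apply: (filter_forall (F := nbhs yb)) => i.
    have cn : - (A'^T *m F (g y) y) @[y --> yb] --> - (A'^T *m F xb yb).
      by apply: (cvgN (F := nbhs yb)); exact: (cvg_mulmx (F := nbhs yb)).
    have cni : (- (A'^T *m F (g y) y)) (lshift p i) 0 @[y --> yb] -->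
        (- (A'^T *m F xb yb)) (lshift p i) 0.
      exact: (mx_cvgP _ _).1 cn _ _.
    by apply: (cvgr_gt _ cni).
  have nact : \forall y \near yb, forall l, l \notin active B b xb ->
      (B *m g y) l 0 < b l 0.
    apply: (filter_forall (F := nbhs yb)) => l; have [la|la] := boolP (l \in active B b xb).
      by near=> y.
    have cB : B *m g y @[y --> yb] --> B *m xb by exact: (cvg_mulmx (F := nbhs yb)).
    have cBl : (B *m g y) l 0 @[y --> yb] --> (B *m xb) l 0.
      exact: (mx_cvgP _ _).1 cB _ _.
    have : \forall y \near yb, (B *m g y) l 0 < b l 0.
      by apply: (cvgr_lt _ cBl); exact: not_active Xb la.
    by apply: filterS => y.
  near=> y => Yy.
  have [_ [Ag _ og]] : regular_at F xb c r2 y /\ eq_solution F A xb r2 y (g y).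
    by near: y.
  have [Bg Hg] : active_rows B b xb *m g y = active_rows B b xb *m xb /\
      H *m g y = H *m xb.
    by apply: eq_col_mx; rewrite -!mul_col_mx.
  have Xg : X (g y).
    split; last by rewrite Hg; case: Xb.
    move=> l; have [la|la] := boolP (l \in active B b xb); last first.
      by apply: ltW; move: l la; near: y.
    rewrite -(enum_rankK_in la la) -active_rowsE Bg active_rowsE.
    by rewrite active_eq.
  (* The multipliers of the equality-constrained problem have kept their sign, so [g y] also solves
     the inequality-constrained one. *)
  have VIg : solves_VI X (fun x => F x y) (g y).
    apply: (multiplier_VI Xb Xg Ag (nu := - (A'^T *m F (g y) y))).
      by rewrite mulmxN opprK; exact: orth_ker.
    by move=> i; apply: ltW; move: i; near: y.
  have [beta b0 [mono _]] := Fmono Yy.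
  exact: VI_unique b0 mono VIg (VIxstar Yy).
- by rewrite (jac_of_diff dg dgE) -/g gb mulNmx.
Unshelve. all: by end_near. Qed.

End Sensitivity.

(** * From the variational inequality back to the game *)

Theorem theorem1 (R : realType) (N n : nat) (d m p : 'I_N -> nat)
  (P : 'M[R]_N)
  (J : forall i : 'I_N, 'cV[R]_n -> 'cV[R]_n -> 'cV[R]_(d i) -> R)
  (X : 'I_N -> set 'cV[R]_n)
  (Y : forall i : 'I_N, set 'cV[R]_(d i))
  (B : forall i : 'I_N, 'M[R]_(m i, n)) (b : forall i : 'I_N, 'cV[R]_(m i))
  (H : forall i : 'I_N, 'M[R]_(p i, n)) (h : forall i : 'I_N, 'cV[R]_(p i))
  (P_ge0 : forall i j, 0 <= P i j)
  (P_diag0 : forall i, P i i = 0)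
  (constraints : forall i,
     X i = polyhedron (B i) (b i) (H i) (h i) /\
     exists xi, X i xi /\ vlt (B i *m xi) (b i))
  (costs_own : forall i (yi : 'cV[R]_(d i)), Y i yi ->
     forall x : 'cV[R]_(\sum_(i < N) n),
       (forall j, j != i -> X j (submxcol x j)) ->
       Ck_on 2 (fun xi => J i xi (aggregate P x i) yi) (X i) /\
       strongly_convex (X i) (fun xi => J i xi (aggregate P x i) yi))
  (costs_joint : forall i (yi : 'cV[R]_(d i)), Y i yi ->
     Ck_on 2 (fun w : 'cV[R]_n * 'cV[R]_n => J i w.1 w.2 yi)
       [set (submxcol x i, aggregate P x i) | x in prodset X])
  (operator_C1 :
     Ck_on 1 (fun w : 'cV[R]_(\sum_(i < N) n) * 'cV[R]_(\sum_(i < N) d i) =>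
                game_op P J w.1 w.2)
       (prodset X `*` prodset Y))
  (operator_monotone : forall y, prodset Y y ->
     strongly_monotone (prodset X) (fun x => game_op P J x y)) :
  (forall y, prodset Y y -> exists! xs, is_nash P J X y xs) /\
  (forall xstar : 'cV[R]_(\sum_(i < N) d i) -> 'cV[R]_(\sum_(i < N) n),
     (forall y, prodset Y y -> is_nash P J X y (xstar y)) ->
   forall ybar, prodset Y ybar ->
     let xbar := xstar ybar in
     let Bs := blkdiag B in let bs := \mxcol_(i < N) b i in
     let Hs := blkdiag H in let hs := \mxcol_(i < N) h i in
     let A := active_mx Bs bs Hs xbar in
     let DxF := jac (fun x => game_op P J x ybar) xbar in
     let DyF := jac (fun y => game_op P J xbar y) ybar in
     let L := invmx DxF in
     let M := L - L *m A^T *m invmx (A *m L *m A^T) *m A *m L in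
     row_free A ->
     (forall lam mu, is_KKT Bs bs Hs hs (game_op P J xbar ybar) xbar lam mu ->
        forall k, (Bs *m xbar) k 0 = bs k 0 -> 0 < lam k 0) ->
     [/\ DxF \in unitmx,
         A *m L *m A^T \in unitmx,
         loc_diff_jac (prodset Y) xstar ybar (- M *m DyF)
       & psd M]).
Proof.
have XE i : X i = polyhedron (B i) (b i) (H i) (h i) by have [] := constraints i.
have PXE := prodset_polyhedron XE.
have segX i : segment_closed (X i) by rewrite XE; exact: polyhedron_segment_closed.
have own i y x : prodset Y y -> prodset X x ->
    differentiable (own_cost P J y x i) (submxcol x i) /\
    strongly_convex (X i) (own_cost P J y x i).
  move=> Yy Xx; have [|[U [_ XU [dU _]]] cvx] := costs_own i _ (Yy i) x.
    by move=> j _; exact: Xx.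
  by split; [apply/dU/XU|exact: cvx].
have NVI y x : prodset Y y -> is_nash P J X y x <->
    solves_VI (prodset X) (fun x => game_op P J x y) x.
  by move=> Yy; apply: nash_VI => // i z Xz; have [] := own i y z Yy Xz.
(* Stacking one feasible strategy per player gives the base point for the existence argument. *)
have [x0 X0] : exists x0, prodset X x0.
  have ex i : exists xi, X i xi by have [_ [xi []]] := constraints i; exists xi.
  exists (\mxcol_i sval (cid (ex i))) => i; rewrite mxcolK.
  exact: svalP (cid (ex i)).
rewrite PXE in operator_C1 operator_monotone X0 NVI; split.
  move=> y Yy; have [x [VIx ux]] := VI_exists_unique operator_C1 operator_monotone X0 Yy.
  by exists x; split=> [|x' /NVI-/(_ Yy)/ux//]; apply/NVI.
move=> xstar Nx yb Yb xb Bs bs Hs hs A DxF DyF L M freeA compl.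
have VIx y : prodset Y y ->
    solves_VI (polyhedron Bs bs Hs hs) (fun x => game_op P J x y) (xstar y).
  by move=> Yy; apply/NVI => //; exact: Nx.
have [posD loc] := VI_sensitivity operator_C1 operator_monotone VIx Yb freeA compl.
split.
- exact: posdef_unitmx.
- exact: schur_unitmx.
- exact: loc.
- exact: saddle_psd.
Qed.
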